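(* Let $\ell$ be a fixed positive integer, $n,p\to\infty$ with $n/p^\ell\to\gamma\in(0,\infty)$, and let $X\in\mathbb R^{n\times p}$ have independent entries with $\mathbb EX_{ij}=0$, $\mathbb EX_{ij}^2=1$, $\mathbb E|X_{ij}|^k\le k^{\beta k}$ for all $k\ge0$ and some fixed $\beta>0$. For each $d\le\ell$ there are constants $C_1,C_3>0$ such that for every $L\in\mathbb N$, almost surely $$\limsup_{n\to\infty}\|T_d(L)\|\le(C_1L)^{C_3}.$$
   Context: Rows and columns of $T_d(L)\in\mathbb R^{\binom pd\times\binom pd}$ are indexed by increasing $d$-tuples of elements of $[p]$. For $L\ge1$, $[T_d(L)]_{ij}=\frac{(d!)^{L/2}}{\sqrt{n^Lp^{dL}}}\sum\prod_{s=1}^dX_{u_1k_s^{(0)}}X_{u_1k_s^{(1)}}X_{u_2k_s^{(1)}}X_{u_2k_s^{(2)}}\cdots X_{u_Lk_s^{(L-1)}}X_{u_Lk_s^{(L)}}$, the sum over $u_1,\dots,u_L\in[n]$ with $u_r\ne u_{r+1}$, and increasing $d$-tuples $(k^{(r)}_s)_{s}$, $0\le r\le L$, with $(k^{(0)}_s)=i$, $(k^{(L)}_s)=j$ and consecutive tuples distinct. $T_d(0)=I$. $\|\cdot\|$ is the spectral norm. *)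

(* Defs.v *)
From HB Require Import structures.
From mathcomp Require Import all_boot all_order all_algebra.
From mathcomp Require Import all_classical all_reals all_analysis.
Set Implicit Arguments. Unset Strict Implicit. Unset Printing Implicit Defensive.
Import Order.TTheory GRing.Theory Num.Theory.
Import numFieldNormedType.Exports.
Local Open Scope classical_set_scope.
Local Open Scope ring_scope.

Definition incr (d p : nat) : predArgType :=
  {t : d.-tuple 'I_p | sorted (fun a b : 'I_p => (a < b)%N) t}.

(* The matrix T_d(L) built from a (realization of an) n x p matrix X,
   rows/columns indexed by increasing d-tuples.  For L >= 1 entry (i,j) is
   (d!)^{L/2}/sqrt(n^L p^{dL}) * sum over u_1..u_L in [n] (here u r, r < L,
   stands for u_{r+1}) with consecutive u distinct, and k^(0..L) increasing
   tuples (here k r, r <= L) with k^(0) = i, k^(L) = j, consecutive distinct,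
   of prod_s prod_{r} X_{u_{r+1} k_s^{(r)}} X_{u_{r+1} k_s^{(r+1)}}.
   T_d(0) = I. *)
Definition Tmat (R : realType) (n p d L : nat) (X : 'I_n -> 'I_p -> R)
    (i j : incr d p) : R :=
  if L == 0%N then (i == j)%:R else
  (Num.sqrt (d`!)%:R) ^+ L / Num.sqrt ((n%:R) ^+ L * (p%:R) ^+ (d * L)) *
  \sum_(u : {ffun 'I_L -> 'I_n} |
          [forall r1 : 'I_L, forall r2 : 'I_L,
             (r2 == r1.+1 :> nat) ==> (u r1 != u r2)])
  \sum_(k : {ffun 'I_L.+1 -> incr d p} |
          [&& k ord0 == i, k ord_max == j &
              [forall r : 'I_L, k (inord r) != k (inord r.+1)]])
  \prod_(s < d) \prod_(r < L)
     (X (u r) (tnth (val (k (inord r))) s) *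
      X (u r) (tnth (val (k (inord r.+1))) s)).

Definition spec_norm (R : realType) (I : finType) (A : I -> I -> R) : R :=
  sup [set Num.sqrt (\sum_(i : I) (\sum_(j : I) A i j * v j) ^+ 2) |
        v in [set v : I -> R | \sum_(j : I) v j ^+ 2 <= 1]].

Definition mutually_independent {dT} {T : measurableType dT} (R : realType)
    (P : probability T R) (I : finType) (Y : I -> T -> R) : Prop :=
  forall (J : {set I}) (B : I -> set R), (forall i, measurable (B i)) ->
    P (\big[setI/setT]_(i in J) (Y i @^-1` B i)) =
    (\prod_(i in J) P (Y i @^-1` B i))%E.

(* Main.v *)
(** Put [Y u k = \prod_(a in k) X u a]. Up to normalization, [T_d(L)] sums the
    weights of the walks [k0, u1, k1, ..., uL, kL] that do not backtrack, and
    [T_d(L)^(2s)] sums over the walks that may backtrack only at multiples of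
    [L]. Since [T_d(L)] is symmetric, [|T|^(2s) <= tr T^(2s)] for [s] a power
    of 2. For [2^s >= p], [s = O(log p)], it therefore suffices to show
    [E tr T^(2s) <= p^d Q^s] with [Q] polynomial in [L]; Markov's inequality
    and the Borel-Cantelli lemma conclude.

    A walk contributes to the expectation only if it never traverses an edge
    [(u, a)] exactly once. If such a walk of [2sL] steps meets [U] rows [u] and
    [V] columns [a] outside its starting tuple, then [dU + V = 2dsL - Delta]
    with [Delta >= 0], and the number of labellings provides a factor
    [p^(-Delta)]. In most steps everything is new (a factor [n p^d / d!]), or
    the walk retraces edges and is forced. The other steps are cheap (a factor
    polynomial in [L], at most [O(s + Delta)] of them) or costly (a factor
    polynomial in [sL], at most [O(Delta)] of them, absorbed by [p^(-Delta)]).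
    This uses that a walk which does not backtrack can only leave a newly
    created tuple through a new row, so that it starts to retrace only at a
    multiple of [L] or after a step that increases [Delta]. *)

Require Import Defs.
From HB Require Import structures.
From mathcomp Require Import all_boot all_order all_algebra.
From mathcomp Require Import all_classical all_reals all_analysis measurable_realfun.
From mathcomp Require Import zify ring lra.
Import Order.TTheory GRing.Theory Num.Theory.
Import numFieldNormedType.Exports.
Set Implicit Arguments. Unset Strict Implicit. Unset Printing Implicit Defensive.

(** * Counting the steps of a walk *)

(** Walks are not encoded. A history is given a weight, a product over its steps, such that the
    weights of all next steps sum to at most $1+2/L$. The histories of length $2sL$ from one tuple
    then weigh at most $(1+2/L)^{2sL}\le e^{4s}$ in total, and it remains to compare the
    contribution of a single walk with its weight. The leading $1$ is the obstacle. Fresh steps have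
    total weight $n\cdot|K|\cdot d!/(np^d)\le1$ and a forced retracing step has weight $1$;
    admitting both after every history would cost $2$ per step, which is exponential in $L$. So each
    is free only right after a step of its own kind ([steady_fresh], [steady_retrace]), and a change
    of kind is paid for as a cheap or costly step. This is why changes of kind have to be counted.
    The normalization contributes $(d!)^{sL}$, which only the factors $d!$ of the steady fresh steps
    compensate. So their number must also be bounded from below, by nearly $sL$. *)

Section Walks.
Variables (I A K : finType) (co : K -> seq A) (d L : nat) (k0 : K).
Hypothesis co_uniq : forall k, uniq (co k).
Hypothesis co_size : forall k, size (co k) = d.
Hypothesis co_inj : forall k k', {subset co k <= co k'} -> k = k'.
Hypothesis d_gt0 : 0 < d.

(* A walk from [k0] is the list of its steps [(u, k)], most recent first. *)
Notation step := (I * K)%type.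
Notation hist := (seq step).
Implicit Types (h : hist) (x : step) (u : I) (a : A).

Definition current h := if h is x :: _ then x.2 else k0.

(* A step [(u, k')] out of [k] traverses the edges [(u, a)], [a] in [k], and then
   the edges [(u, a)], [a] in [k']. An edge of multiplicity 1 is called open. *)
Fixpoint edge_mult h u a : nat :=
  if h is x :: h' then
    (u == x.1) * ((a \in co x.2) + (a \in co (current h'))) + edge_mult h' u a
  else 0.

Definition row_seen h u := u \in map fst h.

Fixpoint col_seen h a :=
  if h is x :: h' then (a \in co x.2) || col_seen h' a else a \in co k0.

(* A good step traverses only open edges, apart from edges that are new because
   their row or, on arrival, their column is new. *)
Definition good_departure h u :=
  ~~ row_seen h u || all (fun a => edge_mult h u a == 1) (co (current h)).
Definition good_arrival h x :=
  all (fun a => ~~ col_seen h a || (edge_mult h x.1 a + (a \in co (current h)) == 1)) (co x.2).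
Definition good h x := good_departure h x.1 && good_arrival h x.

Definition all_new h x := all (fun a => ~~ col_seen h a) (co x.2).
Definition has_new h x := has (fun a => ~~ col_seen h a) (co x.2).

Definition col_open h a := \sum_u (edge_mult h u a == 1).
Definition row_open h u := \sum_a (edge_mult h u a == 1).

(* By [step_kinds], a nonbacktracking step is of exactly one of the kinds fresh,
   overlap, turn, retrace or bad. *)
Definition fresh_step h x := ~~ row_seen h x.1 && all_new h x.
Definition overlap_step h x := [&& good h x, ~~ row_seen h x.1 & ~~ all_new h x].
Definition turn_step h x := [&& good h x, row_seen h x.1 & has_new h x].
Definition retrace_step h x := [&& good h x, row_seen h x.1 & ~~ has_new h x].
Definition bad_step h x := ~~ good h x.
Definition creating_step h x := good h x && has_new h x.

(* Steps that use old labels which are not determined, up to a bounded number of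
   choices, by the open edges. *)
Definition ambiguous_row h x :=
  [&& good h x, row_seen h x.1 & has (fun a => 1 < col_open h a) (co (current h))].
Definition ambiguous_tuple h x :=
  [&& good h x, row_seen h x.1, 2 * d < row_open h x.1 & ~~ all_new h x].
Definition costly_step h x := [|| bad_step h x, ambiguous_row h x | ambiguous_tuple h x].

(* Backtracking is allowed at multiples of [L]. *)
Definition block_end h := L %| size h.
Definition last_step (P : hist -> step -> bool) h := if h is x :: h' then P h' x else false.
Definition steady_fresh h x := [&& ~~ block_end h, last_step fresh_step h & fresh_step h x].
Definition steady_retrace h x :=
  [&& ~~ block_end h, last_step retrace_step h, retrace_step h x & ~~ costly_step h x].
Definition cheap_step h x := [&& ~~ costly_step h x, ~~ steady_fresh h x & ~~ steady_retrace h x].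

Fixpoint count_steps (event : hist -> step -> nat) h :=
  if h is x :: h' then event h' x + count_steps event h' else 0.

Fixpoint nonbacktracking h :=
  if h is x :: h' then
    [&& x.2 != current h', block_end h' || (if h' is y :: _ then x.1 != y.1 else true)
      & nonbacktracking h']
  else true.

Lemma edge_mult_new_row h u a : ~~ row_seen h u -> edge_mult h u a = 0.
Proof.
elim: h => //= x h IH; rewrite /row_seen /= inE negb_or => /andP[/negbTE-> us].
by rewrite IH.
Qed.

Lemma current_col_seen h a : a \in co (current h) -> col_seen h a.
Proof. by case: h => //= x h ->. Qed.

Lemma edge_mult_new_col h u a : ~~ col_seen h a -> edge_mult h u a = 0.
Proof.
elim: h => //= x h IH; rewrite negb_or => /andP[/negbTE-> us].
rewrite IH // (negbTE (contra (@current_col_seen h a) us)).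
by rewrite muln0.
Qed.

Lemma sum_mem (T : finType) (s : seq T) : uniq s -> \sum_y (y \in s) = size s.
Proof.
by move=> /card_uniqP <-; rewrite -sum1_card [RHS]big_mkcond; apply: eq_bigr => a _; case: ifP.
Qed.

Lemma sum_upd (T : finType) (f g : T -> nat) t :
  (forall y, y != t -> f y = g y) -> \sum_y f y + g t = \sum_y g y + f t.
Proof.
move=> fg; rewrite (bigD1 t) //= [in RHS](bigD1 t) //=.
rewrite (eq_bigr g) => [|y /fg //]; lia.
Qed.

Lemma ltn_sum1 (T : finType) (f g : T -> nat) t :
  (forall y, f y <= g y) -> f t < g t -> \sum_y f y < \sum_y g y.
Proof.
move=> fg lt; rewrite (bigD1 t) //= [ltnRHS](bigD1 t) //=.
by rewrite -addSn leq_add //; apply: leq_sum.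
Qed.

Lemma sum_count (T : finType) (s : seq T) (P : pred T) : uniq s ->
  \sum_y ((y \in s) && P y) = count P s.
Proof.
move=> us; rewrite -size_filter -(@sum_mem _ (seq.filter P s)) ?filter_uniq //.
by apply: eq_bigr => a _; rewrite mem_filter andbC.
Qed.

Lemma fresh_step_good h x : fresh_step h x -> good h x.
Proof.
move=> /andP[u0 /allP an]; rewrite /good /good_departure u0 /=.
by apply/allP => a /an ->.
Qed.

Lemma good_arrivalP h x a : good h x -> a \in co x.2 -> col_seen h a ->
  edge_mult h x.1 a + (a \in co (current h)) = 1.
Proof. by move=> /andP[_ /allP H] /H /orP[/negP//|/eqP]. Qed.

Lemma good_departureP h x a : good h x -> row_seen h x.1 -> a \in co (current h) ->
  edge_mult h x.1 a = 1.
Proof. by move=> /andP[+ _] us; rewrite /good_departure us /= => /allP H /H /eqP. Qed.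

Lemma nonbacktracking_new h x : nonbacktracking (x :: h) -> exists2 a, a \in co x.2 & a \notin co (current h).
Proof.
move=> /= /andP[/negP ne _].
case: (boolP (all [in co (current h)] (co x.2))) => [/allP al|/allPn[a a1 a2]].
  by case: ne; apply/eqP/co_inj.
by exists a.
Qed.

Lemma edge_mult_cons h x a :
  edge_mult (x :: h) x.1 a = (a \in co x.2) + (a \in co (current h)) + edge_mult h x.1 a.
Proof. by rewrite /= eqxx mul1n. Qed.

Lemma edge_mult_cons_neq h x u a : u != x.1 -> edge_mult (x :: h) u a = edge_mult h u a.
Proof. by rewrite /= => /negbTE ->. Qed.

Lemma bad_stepP h x : bad_step h x ->
  (exists a, [/\ a \in co (current h), row_seen h x.1 & edge_mult h x.1 a != 1]) \/
  (exists a, [/\ a \in co x.2, col_seen h a & edge_mult h x.1 a + (a \in co (current h)) != 1]).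
Proof.
rewrite /bad_step /good negb_and => /orP[|/allPn[a a1]].
  by rewrite negb_or negbK => /andP[us /allPn[a a1 a2]]; left; exists a.
by rewrite negb_or negbK => /andP[a2 a3]; right; exists a.
Qed.

Definition new_row h x : nat := ~~ row_seen h x.1.
Definition new_cols h x := count (fun a => ~~ col_seen h a) (co x.2).
Definition event (P : hist -> step -> bool) h x : nat := P h x.

Definition at_block_end h (_ : step) := block_end h.
Definition after (P : hist -> step -> bool) h (_ : step) := last_step P h.

Lemma count_event_cons P h x : count_steps (event P) (x :: h) = P h x + count_steps (event P) h.
Proof. by []. Qed.

Lemma sum_mem_tuple k : \sum_a (a \in co k) = d.
Proof. by rewrite sum_mem ?co_size. Qed.

Lemma new_colsE h x : new_cols h x = \sum_a ((a \in co x.2) && ~~ col_seen h a).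
Proof. by rewrite sum_count. Qed.

(** * Traversals of edges against new labels *)

Lemma sum_edge_mult h : \sum_u \sum_a edge_mult h u a = 2 * d * size h.
Proof.
elim: h => [|x h IH]; first by rewrite big1 ?muln0 // => u _; rewrite big1.
have := @sum_upd _ (fun u => \sum_a edge_mult (x :: h) u a) (fun u => \sum_a edge_mult h u a) x.1.
under [X in _ -> _ = _ + X]eq_bigr do rewrite edge_mult_cons.
rewrite !big_split /= !sum_mem_tuple IH => H.
suff /H : forall u, u != x.1 -> \sum_a edge_mult (x :: h) u a = \sum_a edge_mult h u a by rewrite /=; lia.
by move=> u ux; apply: eq_bigr => a _; rewrite edge_mult_cons_neq.
Qed.

(* Each traversal creates an edge for a new label, or closes an open edge, or is
   one of the traversals that make a step bad. *)
Lemma twice_step_le h x :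
  \sum_a (1 < edge_mult (x :: h) x.1 a) + d * new_row h x + new_cols h x + bad_step h x <=
  \sum_a (1 < edge_mult h x.1 a) + 2 * d.
Proof.
have pw a : (1 < edge_mult (x :: h) x.1 a) + (a \in co (current h)) * new_row h x +
     ((a \in co x.2) && ~~ col_seen h a) <=
   (1 < edge_mult h x.1 a) + (a \in co (current h)) + (a \in co x.2).
  rewrite edge_mult_cons /new_row; have := @edge_mult_new_row h x.1 a; have := @edge_mult_new_col h x.1 a.
  have := @current_col_seen h a; lia.
have -> : d * new_row h x = \sum_a ((a \in co (current h)) * new_row h x).
  by rewrite -big_distrl /= sum_mem_tuple.
rewrite new_colsE -!big_split /=.
have -> : \sum_a (1 < edge_mult h x.1 a) + 2 * d =
  \sum_a ((1 < edge_mult h x.1 a) + (a \in co (current h)) + (a \in co x.2)).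
  by rewrite !big_split /= !sum_mem_tuple; lia.
case: (boolP (bad_step h x)) => [/bad_stepP bd|_]; last by rewrite addn0; apply: leq_sum => a _; apply: pw.
rewrite addn1; case: bd => -[a [a1 a2 a3]]; apply: (@ltn_sum1 _ _ _ a) => //;
  rewrite /= eqxx mul1n /new_row; have := @edge_mult_new_row h x.1 a; have := @edge_mult_new_col h x.1 a;
  have := @current_col_seen h a; move: a3; rewrite a1 a2 {pw};
  case: (row_seen h x.1); case: (a \in co (current h)); case: (a \in co x.2); case: (col_seen h a) => /=; lia.
Qed.

Lemma count_twice h :
  d * count_steps new_row h + count_steps new_cols h + count_steps (event bad_step) h +
  \sum_u \sum_a (1 < edge_mult h u a) <= 2 * d * size h.
Proof.
elim: h => [|x h IH]; first by rewrite /= !muln0 !add0n big1 // => u _; rewrite big1.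
have := @sum_upd _ (fun u => \sum_a (1 < edge_mult (x :: h) u a))
  (fun u => \sum_a (1 < edge_mult h u a)) x.1.
have /[swap] /[apply] : forall u, u != x.1 ->
    \sum_a (1 < edge_mult (x :: h) u a) = \sum_a (1 < edge_mult h u a).
  by move=> u ux; apply: eq_bigr => a _; rewrite edge_mult_cons_neq.
have := twice_step_le h x; move: IH; rewrite /event /=; lia.
Qed.

(** A new row creates its edges to the [d] columns of the current tuple, and a new column creates
    its edge to the row of the step. These edges are distinct, since the columns of the current
    tuple are old. *)
Lemma once_step_ge h x :
  \sum_a (0 < edge_mult h x.1 a) + d * new_row h x + new_cols h x <=
  \sum_a (0 < edge_mult (x :: h) x.1 a).
Proof.
have -> : d * new_row h x = \sum_a ((a \in co (current h)) * new_row h x).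
  by rewrite -big_distrl /= sum_mem_tuple.
rewrite new_colsE -!big_split /=; apply: leq_sum => a _.
rewrite eqxx /new_row; have := @edge_mult_new_row h x.1 a; have := @edge_mult_new_col h x.1 a.
have := @current_col_seen h a.
by case: (row_seen h x.1); case: (a \in co (current h)); case: (a \in co x.2); case: (col_seen h a) => /=; lia.
Qed.

Lemma count_once h :
  d * count_steps new_row h + count_steps new_cols h <= \sum_u \sum_a (0 < edge_mult h u a).
Proof.
elim: h => [|x h IH]; first by rewrite /= muln0.
have := @sum_upd _ (fun u => \sum_a (0 < edge_mult (x :: h) u a))
  (fun u => \sum_a (0 < edge_mult h u a)) x.1.
have /[swap] /[apply] : forall u, u != x.1 ->
    \sum_a (0 < edge_mult (x :: h) u a) = \sum_a (0 < edge_mult h u a).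
  by move=> u ux; apply: eq_bigr => a _; rewrite edge_mult_cons_neq.
have := once_step_ge h x; move: IH => /=; lia.
Qed.

(** The entries being centred and independent, the weight of any other walk has mean zero. *)
Definition valid h := forall u a, edge_mult h u a != 1.

(** In a valid walk the edges traversed at least once are those traversed at least twice, so that
    [count_once] and [count_twice] speak of the same edges. *)
Lemma valid_bad h : valid h ->
  2 * (d * count_steps new_row h + count_steps new_cols h) + count_steps (event bad_step) h <= 2 * d * size h.
Proof.
move=> v; have := count_twice h; have := count_once h.
suff -> : \sum_u \sum_a (0 < edge_mult h u a) = \sum_u \sum_a (1 < edge_mult h u a) by lia.
by apply: eq_bigr => u _; apply: eq_bigr => a _; have := v u a; lia.
Qed.

(** Every edge in use takes two of the [2 * d * size h] traversals, and its excess takes the others.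
    The excess governs the moments of order above 2. *)
Lemma valid_excess h : valid h ->
  2 * (d * count_steps new_row h + count_steps new_cols h) + \sum_u \sum_a (edge_mult h u a - 2) <= 2 * d * size h.
Proof.
move=> v; rewrite -sum_edge_mult; have := count_once h.
suff -> : \sum_u \sum_a edge_mult h u a =
  2 * \sum_u \sum_a (0 < edge_mult h u a) + \sum_u \sum_a (edge_mult h u a - 2) by lia.
rewrite big_distrr -big_split; apply: eq_bigr => u _ /=.
by rewrite big_distrr -big_split; apply: eq_bigr => a _ /=; have := v u a; lia.
Qed.

Definition visits h u := count_mem u (map fst h).

Lemma count_new_row h : count_steps new_row h = size (undup (map fst h)).
Proof. by elim: h => //= x h ->; rewrite /new_row /row_seen; case: ifP. Qed.

Lemma visits_useen h u : (0 < visits h u) = row_seen h u.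
Proof. by rewrite -has_count has_pred1. Qed.

Lemma visits_cons h x u : visits (x :: h) u = (x.1 == u) + visits h u.
Proof. by []. Qed.

(** The target of a nonbacktracking step has a column outside its source. If the row is visited only
    once, its edge to this column stays open. *)
Lemma visits_neq1 h u : nonbacktracking h -> (forall a, edge_mult h u a != 1) -> visits h u != 1.
Proof.
elim: h => [|x h IH] // nb v; rewrite visits_cons.
have [xu|xu] := eqVneq x.1 u; last first.
  apply: IH => [|a]; first by case/and3P: nb.
  by have := v a; rewrite /= (eq_sym u) (negbTE xu).
case: (boolP (row_seen h u)) => [|us]; first by rewrite -visits_useen; lia.
have [a a1 a2] := nonbacktracking_new nb.
by have := v a; rewrite /= edge_mult_new_row // xu eqxx a1 (negbTE a2).
Qed.

Lemma valid_visits h u : nonbacktracking h -> valid h -> row_seen h u -> 1 < visits h u.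
Proof.
by move=> nb v; have := visits_neq1 nb (v u); rewrite -visits_useen; lia.
Qed.

Lemma sum_visits h : \sum_u visits h u = size h.
Proof.
elim: h => [|x h IH]; first by rewrite big1.
under eq_bigr do rewrite visits_cons.
rewrite big_split /= IH -add1n; congr (_ + _).
by rewrite (bigD1 x.1) //= eqxx big1 // => u /negbTE; rewrite eq_sym => ->.
Qed.

Lemma valid_new_row h : nonbacktracking h -> valid h -> 2 * count_steps new_row h <= size h.
Proof.
move=> nb v; rewrite -sum_visits count_new_row.
rewrite -(@sum_mem _ (undup (map fst h))) ?undup_uniq // big_distrr /=.
apply: leq_sum => u _; rewrite mem_undup.
by case: (boolP (u \in _)) => // /(valid_visits nb v).
Qed.

(** * Numbers of steps of each kind *)

Lemma row_open_cons h x : row_open (x :: h) x.1 =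
  \sum_a ((a \in co x.2) + (a \in co (current h)) + edge_mult h x.1 a == 1).
Proof. by apply: eq_bigr => a _; rewrite edge_mult_cons. Qed.

Lemma row_open_cons_neq h x u : u != x.1 -> row_open (x :: h) u = row_open h u.
Proof. by move=> ux; apply: eq_bigr => a _; rewrite edge_mult_cons_neq. Qed.

(** From a new row, a good arrival at an old column is possible only if the source contains this
    column too. The step itself then traverses the edge twice. *)
Lemma overlap_step_row_open h x : overlap_step h x -> row_open (x :: h) x.1 < 2 * d.
Proof.
case/and3P => g us /allPn[a a1]; rewrite negbK => a2.
have m0 b : edge_mult h x.1 b = 0 by apply: edge_mult_new_row.
have -> : 2 * d = \sum_a ((a \in co x.2) + (a \in co (current h))).
  by rewrite big_split /= !sum_mem_tuple; lia.
have := good_arrivalP g a1 a2; rewrite row_open_cons m0 => a3.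
apply: (@ltn_sum1 _ _ _ a) => [b|]; rewrite m0; first lia.
by rewrite a1; move: a3; case: (_ \in _).
Qed.

(** The [d] edges of the departure and the [d] edges of the arrival are open beforehand, and
    goodness makes them distinct. *)
Lemma retrace_step_row_open h x : retrace_step h x -> 2 * d <= row_open h x.1.
Proof.
case/and3P => g us /hasPn nn.
have -> : 2 * d = \sum_a ((a \in co x.2) + (a \in co (current h))).
  by rewrite big_split /= !sum_mem_tuple; lia.
apply: leq_sum => a _.
have := @good_departureP h x a g us; have := @good_arrivalP h x a g.
case: (boolP (a \in co x.2)) => [/nn|_]; case: (a \in co (current h)) => //=.
- by rewrite negbK => as1 /(_ isT as1) e /(_ isT); lia.
- by rewrite negbK => as1 /(_ isT as1) e _; lia.
- by move=> _ /(_ isT) ->.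
Qed.

(** The rows visited once whose second visit cannot be a retrace step: the potential in the count of
    overlap steps. It vanishes for valid walks, by [visits_neq1]. *)
Definition pending_rows h := \sum_u ((visits h u == 1) && (row_open h u < 2 * d)).

Lemma step_kinds h x : nonbacktracking (x :: h) ->
  fresh_step h x + overlap_step h x + turn_step h x + retrace_step h x + bad_step h x = 1.
Proof.
rewrite /overlap_step /turn_step /retrace_step /bad_step => nb.
have := @fresh_step_good h x; rewrite /fresh_step.
case: (good h x); case: (row_seen h x.1); case: (all_new h x); case: (has_new h x) => //= H.
all: by have := H isT.
Qed.

(* After an overlap step, the row has fewer than [2 d] open edges, so that the
   next visit of this row cannot be a retrace step. *)
Lemma count_overlap_step h : nonbacktracking h ->
  count_steps (event overlap_step) h <= pending_rows h + count_steps (event turn_step) h + count_steps (event bad_step) h.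
Proof.
elim: h => [|x h IH] // nb; have {}IH := IH (proj2 (andP (proj2 (andP nb)))).
have := @sum_upd _ (fun u => (visits (x :: h) u == 1) && (row_open (x :: h) u < 2 * d) : nat)
  (fun u => (visits h u == 1) && (row_open h u < 2 * d) : nat) x.1.
have /[swap] /[apply] : forall u, u != x.1 ->
   (visits (x :: h) u == 1) && (row_open (x :: h) u < 2 * d) =
   (visits h u == 1) && (row_open h u < 2 * d) :> nat.
  by move=> u ux; rewrite row_open_cons_neq // visits_cons (eq_sym x.1) (negbTE ux).
rewrite -!/(pending_rows _) => ps; move: IH; rewrite !count_event_cons.
have k1 := step_kinds nb; have kA := @overlap_step_row_open h x; have kR := @retrace_step_row_open h x.
have vis : visits (x :: h) x.1 = (visits h x.1).+1 by rewrite visits_cons eqxx.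
rewrite {}vis in ps.
have us : overlap_step h x -> visits h x.1 = 0.
  by case/and3P => _ + _; rewrite -visits_useen; lia.
have us' : fresh_step h x -> visits h x.1 = 0.
  by case/andP => + _; rewrite -visits_useen; lia.
move: us us' kA kR k1 ps.
case: (overlap_step h x); case: (fresh_step h x); case: (retrace_step h x); case: (turn_step h x);
  case: (bad_step h x) => //= us us' kA kR _; try lia.
Qed.

Definition creating_onset h x := creating_step h x && ~~ last_step creating_step h.

Lemma good_new_row_creating h x : nonbacktracking (x :: h) -> good h x -> ~~ row_seen h x.1 -> creating_step h x.
Proof.
move=> nb g us; rewrite /creating_step g /=; have [a a1 a2] := nonbacktracking_new nb.
apply/hasP; exists a => //; apply/negP => as1.
by have := good_arrivalP g a1 as1; rewrite edge_mult_new_row // (negbTE a2).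
Qed.

(* A coordinate introduced at the previous step is only linked to the previous
   row vertex, which a nonbacktracking step leaves. *)
Lemma creating_step_next h x : nonbacktracking (x :: h) -> last_step creating_step h -> ~~ block_end h -> good h x ->
  ~~ row_seen h x.1.
Proof.
case: h => // y h /=; case/and3P => _ + _ /andP[_ /hasP[a a1 a2]] ne g.
rewrite (negbTE ne) /= => xy; apply/negP => us.
have := @good_departureP (y :: h) x a g us; rewrite /= a1 => /(_ isT).
by rewrite (negbTE xy) edge_mult_new_col.
Qed.

(* The walk can stop creating tuples only by a bad step or at a multiple of
   [L], and between two onsets it has to stop. *)
Lemma count_creating_onset h : nonbacktracking h ->
  count_steps (event creating_onset) h <= count_steps (event bad_step) h + count_steps (event at_block_end) h + last_step creating_step h.
Proof.
elim: h => [|x h IH] // nb; have {}IH := IH (proj2 (andP (proj2 (andP nb)))).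
move: IH; rewrite !count_event_cons.
have -> : creating_onset h x = creating_step h x && ~~ last_step creating_step h by [].
have -> : bad_step h x = ~~ good h x by [].
have -> : at_block_end h x = block_end h by [].
have -> : last_step creating_step (x :: h) = creating_step h x by [].
have nx := creating_step_next nb; have gn := good_new_row_creating nb.
have ng : creating_step h x -> good h x by case/andP.
move: nx gn ng; case: (good h x); case: (creating_step h x); case: (last_step creating_step h);
  case: (block_end h); case: (row_seen h x.1) => //= nx gn ng; try lia.
all: try by have := nx isT isT isT.
all: try by have := gn isT isT.
all: by have := ng isT.
Qed.

(** A turn step uses an old row, so by [creating_step_next] it follows a creating step only at a
    block end. Otherwise it is itself an onset. *)
Lemma count_turn_step h : nonbacktracking h ->
  count_steps (event turn_step) h <= count_steps (event creating_onset) h + count_steps (event at_block_end) h.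
Proof.
elim: h => [|x h IH] // nb; have {}IH := IH (proj2 (andP (proj2 (andP nb)))).
rewrite !count_event_cons; suff : turn_step h x <= creating_onset h x + at_block_end h x by lia.
have -> : at_block_end h x = block_end h by [].
case: (boolP (turn_step h x)) => // /and3P[g us hn].
rewrite /creating_onset /creating_step g hn /=.
have := creating_step_next nb; rewrite us g; case: (last_step creating_step h); case: (block_end h) => //.
by move=> /(_ isT isT isT).
Qed.

Lemma count_after (P : hist -> step -> bool) h :
  count_steps (event (after P)) h + last_step P h <= count_steps (event P) h.
Proof. elim: h => // x h IH; rewrite !count_event_cons.
have -> : after P h x = last_step P h by [].
have -> : last_step P (x :: h) = P h x by []; lia. Qed.

Lemma fresh_step_creating h x : fresh_step h x -> creating_step h x.
Proof.
move=> kN; rewrite /creating_step fresh_step_good //=; case/andP: kN => _.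
rewrite /all_new /has_new; case: (co x.2) (co_size x.2) d_gt0 => [<-//|a s _ _ /=].
by case/andP => ->.
Qed.

(** Away from block ends: after a fresh step the row must be new, so a good step that is not fresh
    is an overlap; after a retrace step, a good step that does not retrace creates, hence is an
    onset. In the remaining cases the previous step was bad, an overlap or a turn. *)
Lemma cheap_step_le h x : nonbacktracking (x :: h) ->
  cheap_step h x <= block_end h + last_step bad_step h + last_step overlap_step h + last_step turn_step h + overlap_step h x + creating_onset h x.
Proof.
move=> nb; case: (boolP (cheap_step h x)) => // /and3P[nc nN nR].
case: (boolP (block_end h)) => //= ne; rewrite add0n.
have g : good h x by move: nc; rewrite /costly_step /bad_step !negb_or negbK => /andP[].
have nx nk := creating_step_next nb nk ne g.
have gn := good_new_row_creating nb g.
have kx := step_kinds nb.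
have gb : bad_step h x = false by rewrite /bad_step g.
case: h nb ne nc nN nR g nx gn kx gb => [|y h] nb ne nc nN nR g nx gn kx gb; first by rewrite /block_end dvdn0 in ne.
have ky := step_kinds (proj2 (andP (proj2 (andP nb)))).
rewrite /=.
case: (boolP (fresh_step h y)) => kN.
  have us := nx (fresh_step_creating kN).
  move: nN; rewrite /steady_fresh ne /= kN /= => nN.
  move: kx; rewrite (negbTE nN) gb.
  have -> : turn_step (y :: h) x = false by rewrite /turn_step (negbTE us) andbF.
  have -> : retrace_step (y :: h) x = false by rewrite /retrace_step (negbTE us) andbF.
  by rewrite !addn0 add0n => ->; rewrite addnAC addn1.
case: (boolP (retrace_step h y)) => kR; last first.
  by move: ky; rewrite (negbTE kN) (negbTE kR); clear; lia.
have nk : creating_step h y = false.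
  by case/and3P: kR => _ _; rewrite /creating_step => /negbTE ->; rewrite andbF.
move: nR; rewrite /steady_retrace ne /= kR /= nc andbT => nR.
suff : creating_step (y :: h) x by rewrite /creating_onset /= nk => ->; rewrite /= addnC.
case: (boolP (row_seen (y :: h) x.1)) => // us.
by move: nR; rewrite /retrace_step /creating_step us g /= negbK.
Qed.

(** The counts are chained: onsets are bounded by bad steps and block ends, turns by onsets,
    overlaps by turns and bad steps, the pending rows having disappeared. *)
Lemma count_cheap_step h : nonbacktracking h -> valid h ->
  count_steps (event cheap_step) h <= 8 * count_steps (event bad_step) h + 8 * count_steps (event at_block_end) h + 5.
Proof.
move=> nb v.
have p0 : pending_rows h = 0.
  apply: big1 => u _; case: eqP => //= v1.
  have := visits_neq1 nb (v u); by rewrite v1.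
have : count_steps (event cheap_step) h <= count_steps (event at_block_end) h + count_steps (event (after bad_step)) h
   + count_steps (event (after overlap_step)) h + count_steps (event (after turn_step)) h
   + count_steps (event overlap_step) h + count_steps (event creating_onset) h.
  elim: (h) nb => [|x h' IH] // nb; have {}IH := IH (proj2 (andP (proj2 (andP nb)))).
  have := cheap_step_le nb; rewrite !count_event_cons.
  have e P : last_step P h' = after P h' x by [].
  rewrite !e -[block_end h']/(at_block_end h' x); move: IH; lia.
have := count_after bad_step h; have := count_after overlap_step h; have := count_after turn_step h.
have := count_overlap_step nb; have := count_turn_step nb; have := count_creating_onset nb.
rewrite p0; case: (last_step creating_step h) => /=; lia.
Qed.

(** Steady retrace steps introduce no label, and the other steps at most [2 * d] each. As a valid
    walk lacks only [Del] of the [2 * d * (s * L)] possible labels, this yields the lower bound on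
    the number of steady fresh steps. *)
Lemma count_labels h : nonbacktracking h ->
  d * count_steps new_row h + count_steps new_cols h <=
  2 * d * (count_steps (event steady_fresh) h + count_steps (event cheap_step) h + count_steps (event costly_step) h).
Proof.
elim: h => [|x h IH] nb; first by rewrite muln0.
have {}IH := IH (proj2 (andP (proj2 (andP nb)))).
have : d * new_row h x + new_cols h x <= 2 * d * (steady_fresh h x + cheap_step h x + costly_step h x).
  have V : new_cols h x <= d by rewrite -(co_size x.2) count_size.
  have U : new_row h x <= 1 by rewrite /new_row; case: (~~ _).
  case: (boolP (steady_retrace h x)) => qR.
    case/and4P: qR => _ _ /and3P[_ us /hasPn nn] _.
    have -> : new_cols h x = 0.
      by apply/eqP; rewrite -leqn0 leqNgt -has_count; apply/hasPn.
    by rewrite /new_row us muln0.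
  have -> : steady_fresh h x + cheap_step h x + costly_step h x =
     (steady_fresh h x + cheap_step h x + costly_step h x).-1.+1.
    by rewrite /cheap_step qR; case: (steady_fresh h x); case: (costly_step h x).
  nia.
have cS e : count_steps e (x :: h) = e h x + count_steps e h by [].
move: IH; rewrite !count_event_cons !cS => IH H.
apply: leq_trans (leq_trans (leq_add H IH) _); first by rewrite mulnDr addnACA.
by rewrite -mulnDr leq_mul2l; apply/orP; right; lia.
Qed.

(** The departure closes [d] open edges of the row. The arrival opens one for each new column, but
    closes one more for each old column. *)
Lemma row_open_good h x : good h x -> row_seen h x.1 ->
  row_open (x :: h) x.1 + 2 * ~~ all_new h x <= row_open h x.1.
Proof.
move=> g us; rewrite row_open_cons.
have pw a : ((a \in co x.2) + (a \in co (current h)) + edge_mult h x.1 a == 1) + (a \in co (current h)) +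
    2 * ((a \in co x.2) && col_seen h a) <= (edge_mult h x.1 a == 1) + (a \in co x.2).
  have := @good_departureP h x a g us; have := @good_arrivalP h x a g.
  have := @edge_mult_new_col h x.1 a; have := @current_col_seen h a.
  case: (a \in co x.2); case: (a \in co (current h)); case: (col_seen h a) => //=.
  - by move=> _ _ /(_ isT isT) + /(_ isT); lia.
  - by move=> /(_ isT).
  - by move=> _ _ /(_ isT isT) + _; lia.
  - by move=> _ /(_ isT) -> _ _.
  - by move=> _ _ _ /(_ isT); lia.
  - by move=> /(_ isT).
  - by move=> _ _ _ _; rewrite !addn0.
  - by move=> _ _ _ _; rewrite !addn0.
have H : \sum_a (((a \in co x.2) + (a \in co (current h)) + edge_mult h x.1 a == 1) + (a \in co (current h)) +
    2 * ((a \in co x.2) && col_seen h a)) <=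
    \sum_a ((edge_mult h x.1 a == 1) + (a \in co x.2)) by apply: leq_sum => a _.
move: H; rewrite !big_split /= !sum_mem_tuple big1_eq addn0 sum_count //.
case: (boolP (all_new h x)) => [_|/allPn[a a1]]; first by move=> H; rewrite muln0 addn0; move: H; rewrite /row_open; lia.
rewrite negbK => a2; have : 0 < count (col_seen h) (co x.2).
  by rewrite -has_count; apply/hasP; exists a.
by rewrite muln1 /row_open; lia.
Qed.

Lemma row_open_new h x : ~~ row_seen h x.1 -> row_open (x :: h) x.1 <= 2 * d.
Proof.
move=> us; rewrite row_open_cons.
have -> : 2 * d = \sum_a ((a \in co x.2) + (a \in co (current h))).
  by rewrite big_split /= !sum_mem_tuple; lia.
apply: leq_sum => a _; rewrite edge_mult_new_row // addn0.
by case: (_ \in _); case: (_ \in _).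
Qed.

Lemma row_open_step h x : row_open (x :: h) x.1 <= row_open h x.1 + 2 * d.
Proof.
rewrite row_open_cons.
have -> : row_open h x.1 + 2 * d =
  \sum_a ((edge_mult h x.1 a == 1) + ((a \in co x.2) + (a \in co (current h)))).
  by rewrite !big_split /= !sum_mem_tuple /row_open; lia.
apply: leq_sum => a _.
by case: (a \in co x.2); case: (a \in co (current h)); case: (edge_mult h x.1 a == 1); case: (_ == 1).
Qed.

Definition ambiguous_tuple_at u h x := (x.1 == u) && ambiguous_tuple h x.
Definition bad_step_at u h x := (x.1 == u) && bad_step h x.

(* A good visit of an old row never increases its number of open edges, and an
   ambiguous one lowers it; only bad steps bring it above [2 d]. *)
Lemma count_ambiguous_tuple_at h u :
  2 * count_steps (event (ambiguous_tuple_at u)) h + row_open h u <=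
    2 * d * row_seen h u + 2 * d * count_steps (event (bad_step_at u)) h /\
  count_steps (event (ambiguous_tuple_at u)) h <= d * count_steps (event (bad_step_at u)) h.
Proof.
elim: h => [|x h [IH1 IH2]].
  by rewrite /= !muln0; split=> //; rewrite /row_open big1.
rewrite !count_event_cons {1 3}/ambiguous_tuple_at {1 3}/bad_step_at.
have -> : row_seen (x :: h) u = (x.1 == u) || row_seen h u.
  by rewrite /row_seen /= inE eq_sym.
have [xu|xu] := eqVneq x.1 u; last by rewrite row_open_cons_neq 1?eq_sym // !add0n.
rewrite /= -xu in IH1 IH2 *; rewrite /ambiguous_tuple /bad_step.
have := @row_open_good h x; have := @row_open_new h x; have := row_open_step h x.
move: IH1 IH2; move: (count_steps _ h) (count_steps _ h) (row_open _ _) (row_open _ _) => c1 c2 o1 o2.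
case: (good h x) => /=; last by rewrite !add0n; nia.
case: (row_seen h x.1) => /=; last first.
  by move=> I1 I2 _ /(_ isT) o _; rewrite !add0n; split=> //; nia.
move=> I1 I2 _ _ /(_ isT isT).
case: (ltnP (2 * d) o2); case: (all_new h x) => /=; rewrite ?add0n; nia.
Qed.

Lemma count_steps_sum (T : finType) (P : T -> hist -> step -> bool) (Q : hist -> step -> nat) h :
  (forall h x, Q h x <= \sum_t P t h x) -> count_steps Q h <= \sum_t count_steps (event (P t)) h.
Proof.
move=> H; elim: h => [|x h IH] //.
under eq_bigr do rewrite count_event_cons.
by rewrite big_split /= leq_add.
Qed.

Lemma sum_bad_step_at h : \sum_u count_steps (event (bad_step_at u)) h = count_steps (event bad_step) h.
Proof.
elim: h => [|x h IH]; first by rewrite big1.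
under eq_bigr do rewrite count_event_cons.
rewrite big_split /= IH; congr addn.
rewrite (bigD1 x.1) //= /bad_step_at eqxx big1 ?addn0 // => u /negbTE.
by rewrite eq_sym => ->.
Qed.

Lemma count_ambiguous_tuple h : count_steps (event ambiguous_tuple) h <= d * count_steps (event bad_step) h.
Proof.
rewrite -sum_bad_step_at big_distrr /=.
apply: leq_trans (count_steps_sum (P := ambiguous_tuple_at) _ _) _ => [h' x|].
  by rewrite (bigD1 x.1) //= /ambiguous_tuple_at eqxx leq_addr.
by apply: leq_sum => u _; have [] := count_ambiguous_tuple_at h u.
Qed.

Definition ambiguous_row_at a h x :=
  [&& good h x, row_seen h x.1, 1 < col_open h a & a \in co (current h)].
Definition bad_touches a h x : nat := bad_step h x * ((a \in co (current h)) + (a \in co x.2)).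

Lemma col_open_cons h x a : col_open (x :: h) a + (edge_mult h x.1 a == 1) =
  col_open h a + ((a \in co x.2) + (a \in co (current h)) + edge_mult h x.1 a == 1).
Proof.
rewrite -edge_mult_cons.
apply: (@sum_upd _ (fun u => edge_mult (x :: h) u a == 1 : nat)
  (fun u => edge_mult h u a == 1 : nat)) => u ux.
by rewrite edge_mult_cons_neq.
Qed.

(* Between two visits of a coordinate, good steps keep at most two of its edges
   open, and at most one while the walk stands on it. *)
Lemma count_ambiguous_row_at h a :
  count_steps (event (ambiguous_row_at a)) h + col_open h a <=
    2 * count_steps (bad_touches a) h + (if a \in co (current h) then 1 else 2 * col_seen h a) /\
  count_steps (event (ambiguous_row_at a)) h <= 2 * count_steps (bad_touches a) h.
Proof.
elim: h => [|x h [IH1 IH2]].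
  by rewrite /= !muln0 !add0n /col_open big1 //; split=> //; case: ifP.
rewrite count_event_cons -[count_steps (bad_touches a) _]/(bad_touches a h x + count_steps (bad_touches a) h).
rewrite -[current (x :: h)]/x.2 -[col_seen (x :: h) a]/((a \in co x.2) || col_seen h a).
have := col_open_cons h x a; move: (col_open (x :: h) a) => o1.
have := @good_departureP h x a; have := @good_arrivalP h x a.
have := @edge_mult_new_col h x.1 a; have := @edge_mult_new_row h x.1 a; have := @current_col_seen h a.
rewrite {1 3}/ambiguous_row_at {1 3}/bad_touches /bad_step.
move: IH1 IH2; move: (count_steps _ h) (count_steps _ h) (col_open _ _) (edge_mult _ _ _) => c1 c2 o m.
case: (good h x); case: (row_seen h x.1); case: (a \in co (current h));
  case: (a \in co x.2); case: (col_seen h a) => //= I1 I2 H1 H2 H3 H4 H5 E;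
  try (have := H1 isT => //); try have {}H2 := H2 isT; try have {}H3 := H3 isT;
  try have {}H4 := H4 isT isT isT; try have {}H5 := H5 isT isT isT;
  rewrite ?muln0 ?muln1 ?add0n ?addn0 ?mul1n ?mul0n ?andbF ?andbT in I1 I2 H4 H5 E *;
  try (split; lia).
all: case: (ltnP 1 o) => /= oo; try (split; lia).
Qed.

Lemma count_ambiguous_row h : count_steps (event ambiguous_row) h <= 4 * d * count_steps (event bad_step) h.
Proof.
have -> : 4 * d * count_steps (event bad_step) h = \sum_a 2 * count_steps (bad_touches a) h.
  elim: h => [|x h IH]; first by rewrite muln0 big1.
  under eq_bigr do rewrite -[count_steps (bad_touches _) _]/(bad_touches _ h x + count_steps (bad_touches _) h) mulnDr.
  rewrite big_split /= -IH mulnDr; congr addn.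
  by rewrite -big_distrr /= -big_distrr /= big_split /= !sum_mem_tuple /event; case: (bad_step h x); lia.
apply: leq_trans (count_steps_sum (P := ambiguous_row_at) _ _) _ => [h' x|].
  rewrite /event; case: (boolP (ambiguous_row h' x)) => // /and3P[g us /hasP[a a1 a2]].
  by rewrite (bigD1 a) //= /ambiguous_row_at g us a1 a2.
by apply: leq_sum => a _; have [] := count_ambiguous_row_at h a.
Qed.

Lemma count_costly_step h : count_steps (event costly_step) h <= (1 + 5 * d) * count_steps (event bad_step) h.
Proof.
have := count_ambiguous_row h; have := count_ambiguous_tuple h.
suff : count_steps (event costly_step) h <= count_steps (event bad_step) h + count_steps (event ambiguous_row) h + count_steps (event ambiguous_tuple) h by lia.
elim: h => // x h IH; rewrite !count_event_cons.
have -> : costly_step h x = [|| bad_step h x, ambiguous_row h x | ambiguous_tuple h x] by [].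
move: IH; case: (bad_step h x); case: (ambiguous_row h x); case: (ambiguous_tuple h x) => /=; lia.
Qed.

(** * Uniqueness of the old labels of unambiguous steps *)

Lemma good_open h x a : good h x -> row_seen h x.1 -> a \in co x.2 -> col_seen h a ->
  edge_mult h x.1 a = 1 /\ a \notin co (current h).
Proof.
move=> g us a1 a2; have := good_arrivalP g a1 a2; have := @good_departureP h x a g us.
by case: (a \in co (current h)) => [/(_ isT) ->|]; rewrite ?addn0.
Qed.

(** A good departure through an old row uses an open edge at each column of the current tuple, and
    without ambiguity such a column has only one. *)
Lemma row_unique h x y : good h x -> row_seen h x.1 -> ~~ costly_step h x ->
  good h y -> row_seen h y.1 -> x.1 = y.1.
Proof.
move=> gx ux; rewrite /costly_step !negb_or => /and3P[_ + _]; rewrite /ambiguous_row gx ux /=.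
move=> /hasPn am gy uy.
have /hasP[a a1 _] : has predT (co (current h)) by rewrite has_predT co_size.
have := am a a1; rewrite -leqNgt /col_open (bigD1 x.1) //= (good_departureP gx) //=.
have [//|yx] := eqVneq x.1 y.1.
by rewrite (bigD1 y.1) 1?eq_sym //= (good_departureP gy) //= addnA.
Qed.

(** The rows agree by [row_unique]. A column of [x.2] outside [y.2] would be joined to this row by
    an open edge besides the [2 * d] ones to the current tuple and to [y.2], and more than [2 * d]
    open edges would make the step ambiguous. *)
Lemma retrace_step_unique h x y : retrace_step h x -> ~~ costly_step h x ->
  retrace_step h y -> ~~ costly_step h y -> x = y.
Proof.
move=> /and3P[gx ux /hasPn sx] cx /and3P[gy uy /hasPn sy] cy.
have e1 := row_unique gx ux cx gy uy.
rewrite [x]surjective_pairing [y]surjective_pairing e1; congr pair.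
apply: co_inj => a a1; apply/negPn/negP => a2.
have {}sy b : b \in co y.2 -> col_seen h b by move=> /sy; rewrite negbK.
have {}sx b : b \in co x.2 -> col_seen h b by move=> /sx; rewrite negbK.
have : row_open h y.1 <= 2 * d.
  move: cy; rewrite /costly_step !negb_or => /and3P[_ _]; rewrite /ambiguous_tuple gy uy /=.
  rewrite negb_and negbK -leqNgt => /orP[//|/allP an].
  have /hasP[b b1 _] : has predT (co y.2) by rewrite has_predT co_size.
  by have := an b b1; rewrite sy.
rewrite leqNgt => /negP; apply.
have -> : (2 * d).+1 = \sum_b ((b \in co (current h)) + (b \in co y.2) + (b == a)).
  rewrite !big_split /= !sum_mem_tuple (bigD1 a) //= eqxx big1; first lia.
  by move=> b /negbTE ->.
apply: leq_sum => b _.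
have := @good_departureP h y b gy uy; have := fun by2 => good_open gy uy by2 (sy b by2).
have [->|_] := eqVneq b a.
  have := good_open gx ux a1 (sx a a1); rewrite e1 => -[-> /negbTE ->] _ _.
  by rewrite (negbTE a2).
case: (b \in co y.2) => [/(_ isT)[-> /negbTE ->] //|_].
by case: (b \in co (current h)) => // /(_ isT) ->.
Qed.

(** * Totals for a valid walk *)

Lemma sum_row_seen h : \sum_u row_seen h u <= size h.
Proof. by rewrite -sum_visits leq_sum // => u _; rewrite -visits_useen; case: visits. Qed.

Lemma sum_col_seen h : \sum_a col_seen h a <= d * (size h).+1.
Proof.
elim: h => [|x h IH]; first by rewrite /= sum_mem_tuple muln1.
apply: leq_trans (_ : \sum_a ((a \in co x.2) + col_seen h a) <= _).
  by apply: leq_sum => a _ /=; case: (_ \in _).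
by rewrite big_split /= sum_mem_tuple [leqRHS]mulnS leq_add.
Qed.

Lemma steady_fresh_costly h x : steady_fresh h x -> ~~ costly_step h x.
Proof.
case/and3P=> _ _ kN; rewrite /costly_step /bad_step /ambiguous_row /ambiguous_tuple (fresh_step_good kN) /=.
by case/andP: kN => /negbTE ->.
Qed.

Lemma count_at_block_end h : 0 < L -> count_steps (event at_block_end) h = (size h + L.-1) %/ L.
Proof.
move=> L0; elim: h => [|x h IH]; first by rewrite divn_small // prednK.
rewrite count_event_cons IH /= addSn divnS // -addnS prednK //.
by rewrite dvdn_addl // dvdnn.
Qed.

Lemma steady_fresh_new_row h : count_steps (event steady_fresh) h <= count_steps new_row h.
Proof.
elim: h => // x h IH; rewrite count_event_cons -[count_steps new_row _]/(new_row h x + count_steps new_row h).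
apply: leq_add => //; rewrite /steady_fresh /fresh_step /new_row.
by case: (row_seen h x.1); rewrite /= ?andbF //; case: (_ && _).
Qed.

(* [Del] is the [Delta] of the introduction, and [s * L] half the length. *)
Lemma count_bounds h s : 0 < L -> 0 < s -> nonbacktracking h -> valid h -> size h = 2 * s * L ->
  exists2 Del, d * count_steps new_row h + count_steps new_cols h + Del = 2 * d * (s * L) &
  [/\ \sum_u \sum_a (edge_mult h u a - 2) <= 2 * Del, count_steps new_row h <= s * L,
     s * L <= count_steps (event steady_fresh) h + (count_steps (event cheap_step) h + count_steps (event costly_step) h + Del),
     count_steps (event cheap_step) h <= 16 * Del + 21 * s &
     count_steps (event costly_step) h <= 2 * (1 + 5 * d) * Del].
Proof.
move=> L0 s0 nb v sz.
have := valid_excess v; have := valid_bad v; have := valid_new_row nb v.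
have := count_cheap_step nb v; have := count_labels nb; have := count_costly_step h.
rewrite count_at_block_end // sz.
have -> : (2 * s * L + L.-1) %/ L = 2 * s by rewrite divnMDl // divn_small ?addn0 // prednK.
move: (count_steps new_row h) (count_steps new_cols h) (count_steps (event bad_step) h) (\sum_u _) => U V b ex.
move: (count_steps (event steady_fresh) h) (count_steps (event cheap_step) h) (count_steps (event costly_step) h) => q ch ct.
have -> : 2 * s * L = 2 * (s * L) by rewrite mulnA.
move: (s * L) => h0 ctb lab chb U2 Jb Je.
exists (2 * d * h0 - (d * U + V)); first by rewrite subnKC //; nia.
set Del := _ - _; have JE : d * U + V + Del = 2 * d * h0 by rewrite subnKC //; nia.
have bD : b <= 2 * Del by nia.
(* In the bound for cheap steps, [16 * Del] is [8 * b], while [21 * s] consists of [8] for each of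
   the [2 * s] block ends and of the constant [5 <= 5 * s]. *)
split; [nia | lia | | lia | nia].
have : 2 * d * h0 <= 2 * d * (q + (ch + ct + Del)).
  by rewrite -JE; move: lab d_gt0; clear; nia.
by rewrite leq_pmul2l // muln_gt0.
Qed.

Lemma leq_expn_base m1 m2 e : m1 <= m2 -> m1 ^ e <= m2 ^ e.
Proof. by case: e => [|e] le12; rewrite ?expn0 // leq_exp2r. Qed.

(** The contribution of a walk against its weight, with denominators cleared. The hypothesis on [p]
    lists the price of one unit of [Del]: [B0 ^ 2] for the excess, [c ^ 16] for cheap steps, the
    power of [c'] for costly steps, and [d! * C0] for missing fresh steps. One factor [p] pays for
    all of them. *)
Lemma label_count_le h n p C0 B0 M1 s : 0 < L -> 0 < p -> 0 < C0 -> 0 < B0 -> 0 < M1 ->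
  0 < s -> p ^ d <= C0 * n -> nonbacktracking h -> valid h -> size h = 2 * s * L ->
  let K1 := 2 * (1 + 2 * d) ^ d in
  let c := L * K1 * d`! * C0 in
  let c' := L * M1 * d`! * C0 in
  B0 ^ 2 * c ^ 16 * c' ^ (2 * (1 + 5 * d)) * (d`! * C0) <= p ->
  B0 ^ (\sum_u \sum_a (edge_mult h u a - 2)) * (n ^ count_steps new_row h * p ^ count_steps new_cols h) *
    ((L * K1) ^ count_steps (event cheap_step) h * (L * M1) ^ count_steps (event costly_step) h) * d`! ^ (s * L) <=
  n ^ (s * L) * p ^ (d * (s * L)) * (c ^ 21) ^ s * d`! ^ count_steps (event steady_fresh) h.
Proof.
move=> L0 p0 C00 B00 M10 s0 pdn nb v sz K1 c c' big.
have [Del JE [exD Uh hq chD ctD]] := count_bounds L0 s0 nb v sz.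
have qU := steady_fresh_new_row h.
move: (count_steps new_row h) (count_steps new_cols h) (\sum_u _) JE exD Uh hq chD ctD qU => U V ex.
move: (count_steps (event steady_fresh) h) (count_steps (event cheap_step) h) (count_steps (event costly_step) h) => q ch ct.
move: (s * L) => h0 JE exD Uh hq chD ctD qU.
have D0 : 0 < d`! by rewrite fact_gt0.
have c0 : 0 < c by rewrite !muln_gt0 L0 D0 C00 expn_gt0.
have c'0 : 0 < c' by rewrite !muln_gt0 L0 D0 C00 M10.
have pexp m e e' : 0 < m -> e <= e' -> m ^ e <= m ^ e' by move=> m0; exact: leq_pexp2l.
(* [w] bounds both deficits: [h0 - q], which costs factors [d!], and, since [q <= U], also [h0 - U],
   each unit of which trades [p ^ d] for [C0 * n]. *)
set w := ch + ct + Del in hq *.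
have H1 : d`! ^ h0 <= d`! ^ q * d`! ^ w by rewrite -expnD pexp.
have H2 : n ^ U * p ^ V * p ^ Del <= n ^ h0 * p ^ (d * h0) * C0 ^ w.
  have -> : n ^ U * p ^ V * p ^ Del = n ^ U * (p ^ (d * h0) * (p ^ d) ^ (h0 - U)).
    rewrite -mulnA -expnD -expnM -expnD; congr (_ * p ^ _).
    move: JE Uh; clear; nia.
  have Xw : (p ^ d) ^ (h0 - U) <= C0 ^ w * n ^ (h0 - U).
    apply: leq_trans (_ : (C0 * n) ^ (h0 - U) <= _); first exact: leq_expn_base.
    rewrite expnMn leq_mul2r pexp ?orbT //; move: hq qU; clear; lia.
  rewrite -[X in n ^ X * p ^ _ * _](subnKC Uh) expnD -!mulnA leq_mul2l.
  by rewrite [X in _ <= X]mulnCA leq_mul2l [X in _ <= X]mulnC Xw !orbT.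
have H3 : B0 ^ ex * ((L * K1) ^ ch * (L * M1) ^ ct) * d`! ^ w * C0 ^ w <=
    (c ^ 21) ^ s * p ^ Del.
  have -> : B0 ^ ex * ((L * K1) ^ ch * (L * M1) ^ ct) * d`! ^ w * C0 ^ w =
     B0 ^ ex * c ^ ch * c' ^ ct * (d`! * C0) ^ Del.
    by rewrite /c /c' /w !expnMn !expnD; ring.
  apply: leq_trans (_ : _ <= B0 ^ (2 * Del) * c ^ (16 * Del + 21 * s) *
     c' ^ (2 * (1 + 5 * d) * Del) * (d`! * C0) ^ Del) _.
    by rewrite !leq_mul // pexp.
  rewrite expnD !(expnM _ _ Del) (expnM _ _ s).
  have -> : (B0 ^ 2) ^ Del * ((c ^ 16) ^ Del * (c ^ 21) ^ s) *
     (c' ^ (2 * (1 + 5 * d))) ^ Del * (d`! * C0) ^ Del =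
    (c ^ 21) ^ s * (B0 ^ 2 * c ^ 16 * c' ^ (2 * (1 + 5 * d)) * (d`! * C0)) ^ Del.
    by rewrite !expnMn; ring.
  by rewrite leq_mul2l leq_expn_base ?orbT.
rewrite -(leq_pmul2r (_ : 0 < p ^ Del * (d`! ^ w * C0 ^ w))); last first.
  by rewrite !muln_gt0 !expn_gt0 p0 D0 C00.
have -> : B0 ^ ex * (n ^ U * p ^ V) * ((L * K1) ^ ch * (L * M1) ^ ct) * d`! ^ h0 *
    (p ^ Del * (d`! ^ w * C0 ^ w)) =
  n ^ U * p ^ V * p ^ Del *
    (B0 ^ ex * ((L * K1) ^ ch * (L * M1) ^ ct) * d`! ^ w * C0 ^ w) * d`! ^ h0 by ring.
have -> : n ^ h0 * p ^ (d * h0) * (c ^ 21) ^ s * d`! ^ q *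
    (p ^ Del * (d`! ^ w * C0 ^ w)) =
  n ^ h0 * p ^ (d * h0) * C0 ^ w * ((c ^ 21) ^ s * p ^ Del) * (d`! ^ q * d`! ^ w) by ring.
exact: leq_mul (leq_mul H2 H3) H1.
Qed.

End Walks.
Local Open Scope ring_scope.

(** * Summing weights over walks *)

Section Transfer.
Variables (R : realFieldType) (I A K : finType) (d L : nat) (ct : K -> d.-tuple A) (k0 : K).
Notation co := (fun k => tval (ct k)).
Hypothesis co_uniq : forall k, uniq (ct k).
Hypothesis co_inj : forall k k', {subset ct k <= ct k'} -> k = k'.
Hypothesis d_gt0 : (0 < d)%N.
Hypothesis L_gt0 : (0 < L)%N.
Hypothesis I_gt0 : (0 < #|I|)%N.
Hypothesis A_gt0 : (0 < #|A|)%N.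
Hypothesis K_card : (#|K| * d`! <= #|A| ^ d)%N.

Let step := (I * K)%type.
Let hist := seq step.
Let size_co : forall k, size (ct k) = d. Proof. by move=> k; rewrite size_tuple. Qed.
Implicit Types (h : hist) (x : step).

Notation n := (#|I|%:R : R).
Notation p := (#|A|%:R : R).

(** The expanded power is a sum over all maps ['I_d -> A], in which each tuple [ct k] appears. The
    factor [d!] lost here matters only for steady fresh steps, which are summed by [K_card]
    instead. *)
Lemma sum_prod_tuple (g : A -> R) : (forall a, 0 <= g a) ->
  \sum_k \prod_(a <- ct k) g a <= (\sum_a g a) ^+ d.
Proof.
move=> g0; have -> : (\sum_a g a) ^+ d = \prod_(i < d) \sum_a g a.
  by rewrite prodr_const card_ord.
rewrite bigA_distr_bigA /=.
pose F k := [ffun i => tnth (ct k) i].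
have Finj : injective F.
  move=> k k' /ffunP e; apply: co_inj => a.
  suff -> : ct k = ct k' by [].
  by apply: eq_from_tnth => i; have := e i; rewrite !ffunE.
rewrite (eq_bigr (fun k => \prod_i g (F k i))); last first.
  by move=> k _; rewrite big_tuple; apply: eq_bigr => i _; rewrite ffunE.
rewrite -(big_imset (fun f : {ffun 'I_d -> A} => \prod_i g (f i))) /=; last first.
  by move=> ? ? _ _ /Finj.
rewrite [leRHS](bigID [in F @: K]) /= lerDl sumr_ge0 // => f _.
by rewrite prodr_ge0.
Qed.

Definition label_weight h x : R := n^-1 ^+ new_row h x * p^-1 ^+ new_cols co k0 h x.

Variables (c1 c2 : R).
Hypotheses (c1_ge0 : 0 <= c1) (c2_ge0 : 0 <= c2).

(* The weights are chosen such that their sum over the possible next steps is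
   close to 1, see [sum_step_weight]. *)
Definition step_weight h x : R :=
  label_weight h x * (d`!%:R ^+ steady_fresh co L k0 h x * c1 ^+ cheap_step co d L k0 h x *
   c2 ^+ costly_step co d k0 h x).

Fixpoint history_weight h : R := if h is x :: h' then step_weight h' x * history_weight h' else 1.

Lemma history_weightE h : history_weight h =
  n^-1 ^+ count_steps (@new_row _ _) h * p^-1 ^+ count_steps (new_cols co k0) h *
  (d`!%:R ^+ count_steps (event (steady_fresh co L k0)) h * c1 ^+ count_steps (event (cheap_step co d L k0)) h *
   c2 ^+ count_steps (event (costly_step co d k0)) h).
Proof.
elim: h => [|x h IH]; first by rewrite /= !expr0 !mulr1.
rewrite /= IH /step_weight /label_weight /event !exprD.
move: (n^-1 ^+ new_row h x) (n^-1 ^+ count_steps _ h) (p^-1 ^+ new_cols co k0 h x) (p^-1 ^+ count_steps _ h).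
move: (_ ^+ steady_fresh co L k0 h x) (_ ^+ cheap_step co d L k0 h x) (_ ^+ costly_step co d k0 h x).
move: (_ ^+ count_steps _ h) (_ ^+ count_steps _ h) (_ ^+ count_steps _ h) => *; ring.
Qed.

Definition col_weight h (a : A) : R := if col_seen co k0 h a then 1 else p^-1.

Lemma prod_col_weight h x : p^-1 ^+ new_cols co k0 h x = \prod_(a <- ct x.2) col_weight h a.
Proof.
rewrite /new_cols; elim: (tval (ct x.2)) => [|a s IH]; first by rewrite big_nil.
by rewrite /= exprD IH big_cons /col_weight; case: (col_seen _ _ _ _); rewrite ?expr0 ?expr1.
Qed.

Let n_gt0 : 0 < n. Proof. by rewrite ltr0n. Qed.
Let p_gt0 : 0 < p. Proof. by rewrite ltr0n. Qed.

Lemma label_weight_ge0 h x : 0 <= label_weight h x.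
Proof. by rewrite mulr_ge0 // exprn_ge0 // invr_ge0 ltW. Qed.

Lemma sum_const_inv (T : finType) (P : pred T) : \sum_(t | P t) (#|T|%:R : R)^-1 <= 1.
Proof.
apply: le_trans (_ : \sum_(t : T) #|T|%:R^-1 <= _).
  by rewrite [leRHS](bigID P) /= lerDl sumr_ge0 // => *; rewrite invr_ge0.
rewrite sumr_const -[_ *+ _]mulr_natr.
have [->|T0] := eqVneq #|T| 0%N; first by rewrite mulr0.
by rewrite mulVf // pnatr_eq0.
Qed.

Lemma col_weight_ge0 h a : 0 <= col_weight h a.
Proof. by rewrite /col_weight; case: ifP => // _; rewrite invr_ge0 ltW. Qed.

(** Each of the [d] coordinates is new, with total weight at most 1, or one of at most [c]
    admissible old columns. *)
Lemma sum_tuples h (S : pred A) (P : pred K) (c : nat) :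
  (forall k a, P k -> a \in ct k -> col_seen co k0 h a -> S a) ->
  (\sum_a S a <= c)%N ->
  \sum_(k | P k) \prod_(a <- ct k) col_weight h a <= (1 + c%:R) ^+ d.
Proof.
move=> PS Sc; pose g a : R := (~~ col_seen co k0 h a)%:R * p^-1 + (S a)%:R.
have g0 a : 0 <= g a by rewrite addr_ge0 // mulr_ge0 // invr_ge0 ltW.
apply: le_trans (_ : (\sum_a g a) ^+ d <= _); last first.
  rewrite lerXn2r ?nnegrE ?sumr_ge0 ?addr_ge0 //.
  rewrite big_split /= lerD //.
    apply: le_trans (sum_const_inv (fun a => ~~ col_seen co k0 h a)).
    rewrite [leRHS]big_mkcond ler_sum // => a _.
    by case: (~~ _); rewrite ?mul1r ?mul0r.
  by rewrite -natr_sum ler_nat.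
apply: le_trans (sum_prod_tuple g0).
rewrite big_mkcond ler_sum // => k _; case: ifP => Pk; last by rewrite prodr_ge0.
rewrite big_seq [leRHS]big_seq ler_prod // => a ak; rewrite col_weight_ge0 /=.
rewrite /col_weight /g; case: ifP => [as1|_]; last by rewrite mul1r lerDl.
by rewrite (PS k a Pk ak as1) mul0r add0r.
Qed.

Lemma sum_new_row h : \sum_(u | ~~ row_seen h u) n^-1 ^+ @new_row _ K h (u, k0) <= 1.
Proof.
apply: le_trans (sum_const_inv (fun u => ~~ row_seen h u)).
by apply: ler_sum => u us; rewrite /new_row us expr1.
Qed.

Lemma label_weight_pair h u k : label_weight h (u, k) =
  n^-1 ^+ @new_row _ K h (u, k0) * \prod_(a <- ct k) col_weight h a.
Proof. by rewrite /label_weight prod_col_weight. Qed.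

Lemma sum_label_weight h M : (size h < M)%N ->
  \sum_x label_weight h x <= (1 + M%:R) * (1 + (d * M)%:R) ^+ d.
Proof.
move=> hM; have -> : \sum_x label_weight h x = \sum_u \sum_k label_weight h (u, k).
  by rewrite pair_bigA; apply: eq_bigr => -[].
under eq_bigr do (under eq_bigr do rewrite label_weight_pair; rewrite -big_distrr /=).
rewrite -big_distrl /= ler_pM //.
- by rewrite sumr_ge0 // => u _; rewrite exprn_ge0 // invr_ge0 ltW.
- by rewrite sumr_ge0 // => k _; rewrite prodr_ge0 // => a _; apply: col_weight_ge0.
- rewrite (bigID (row_seen h)) /= addrC lerD ?sum_new_row //.
  apply: le_trans (_ : \sum_(u | row_seen h u) 1 <= _).
    by apply: ler_sum => u us; rewrite /new_row us.
  rewrite sumr_const -[_ *+ _]mulr_natr mul1r ler_nat.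
  rewrite -sum1_card big_mkcond /=; apply: leq_trans (leq_trans (sum_row_seen h) (ltnW hM)).
  by apply: leq_sum => u _; rewrite -[u \in _]/(row_seen h u); case: row_seen.
- apply: (@sum_tuples _ (col_seen co k0 h)) => //.
    apply: leq_trans (sum_col_seen k0 co_uniq size_co h) _.
  by rewrite leq_mul2l hM orbT.
Qed.

(** If the row is new, the old columns reached lie in the current tuple. If it is old, it is
    determined by [row_unique], and the columns reached are all new or joined to it by one of at
    most [2 * d] open edges. Each case contributes [(1 + 2 * d) ^ d]. *)
Lemma sum_label_weight_regular h :
  \sum_(x | good co k0 h x && ~~ costly_step co d k0 h x) label_weight h x <=
  (2 * (1 + 2 * d) ^ d)%:R.
Proof.
rewrite (bigID (fun x => row_seen h x.1)) /= addrC.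
have -> : (2 * (1 + 2 * d) ^ d)%:R = (1 + (2 * d)%:R) ^+ d + (1 + (2 * d)%:R) ^+ d :> R.
  by rewrite natrM natrX natrD mulrDl mul1r.
rewrite lerD //.
  apply: le_trans (_ : \sum_(x | ~~ row_seen h x.1 && good_arrival co k0 h x) label_weight h x <= _).
    rewrite big_mkcond [leRHS]big_mkcond ler_sum // => x _.
    case: ifP => [/andP[/andP[/andP[_ ->] _] ->] //|_].
    by case: ifP => // _; apply: label_weight_ge0.
  have -> : \sum_(x | ~~ row_seen h x.1 && good_arrival co k0 h x) label_weight h x =
      \sum_(u | ~~ row_seen h u) \sum_(k | good_arrival co k0 h (u, k)) label_weight h (u, k).
    by rewrite pair_big_dep; apply: eq_big => -[].
  rewrite -[leRHS]mul1r.
  apply: le_trans (_ : \sum_(u | ~~ row_seen h u) n^-1 ^+ @new_row _ K h (u, k0) *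
     (1 + (2 * d)%:R) ^+ d <= _); last first.
    by rewrite -big_distrl /= ler_wpM2r ?sum_new_row // exprn_ge0 // addr_ge0.
  apply: ler_sum => u us.
  under eq_bigr do rewrite label_weight_pair; rewrite -big_distrr /=; apply: ler_wpM2l.
    by rewrite exprn_ge0 // invr_ge0 ltW.
  apply: (@sum_tuples _ [in co (current k0 h)]).
    move=> k a /allP gk /gk + as1; rewrite as1 /= (edge_mult_new_row _ _ _ us) add0n.
    by case: (_ \in _).
  by rewrite (sum_mem_tuple co_uniq size_co) leq_pmull.
have [/existsP[x /andP[/andP[gx nc] ux]]|none] := boolP
  [exists x, (good co k0 h x && ~~ costly_step co d k0 h x) && row_seen h x.1]; last first.
  rewrite big_pred0 ?exprn_ge0 ?addr_ge0 // => x; apply/negP => ax.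
  by move/existsP: none; apply; exists x.
set u := x.1 in ux.
have same y : (good co k0 h y && ~~ costly_step co d k0 h y) && row_seen h y.1 -> y.1 = u.
  move=> /andP[/andP[gy cy] uy]; apply/esym.
  exact: (row_unique size_co d_gt0 gx ux nc gy uy).
pose P k := good co k0 h (u, k) && ~~ costly_step co d k0 h (u, k).
apply: le_trans (_ : \sum_(k | P k) label_weight h (u, k) <= _).
  apply: le_trans (_ : \sum_(y | (y.1 == u) && P y.2) label_weight h y <= _).
    rewrite big_mkcond [leRHS]big_mkcond ler_sum // => -[v k] _ /=.
    case: ifP => ay; last by case: ifP => // _; apply: label_weight_ge0.
    have e := same (v, k) ay; rewrite /= in e; rewrite {}e in ay *.
    by rewrite eqxx /P /=; case/andP: ay => ->.
  have -> : \sum_(y | (y.1 == u) && P y.2) label_weight h y =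
      \sum_(v | v == u) \sum_(k | P k) label_weight h (v, k).
    by rewrite pair_big; apply: eq_big => -[].
  by rewrite big_pred1_eq.
have n1 : n^-1 ^+ @new_row _ K h (u, k0) = 1 by rewrite /new_row ux expr0.
under eq_bigr do rewrite label_weight_pair n1 mul1r.
have [am|am] := ltnP (2 * d) (row_open co k0 h u).
  apply: le_trans (_ : (1 + 0%:R) ^+ d <= _); last first.
    by rewrite lerXn2r ?nnegrE ?addr_ge0 // lerD2l ler_nat.
  apply: (@sum_tuples _ pred0); last by rewrite big1.
  move=> k a /andP[gk]; rewrite /costly_step !negb_or => /and3P[_ _].
  by rewrite /ambiguous_tuple gk ux am /= negbK => /allP H /H /negbTE ->.
apply: (@sum_tuples _ (fun a => edge_mult co k0 h u a == 1%N)); last exact: am.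
move=> k a /andP[gk _] ak as1.
by have [/= -> _] := good_open gk ux ak as1.
Qed.

Lemma sum_step_weight h M : (size h < M)%N ->
  \sum_x step_weight h x <= 1 + c1 * (2 * (1 + 2 * d) ^ d)%:R +
     c2 * ((1 + M%:R) * (1 + (d * M)%:R) ^+ d).
Proof.
move=> hM.
(* [wN] is the weight of one steady fresh step, charged to every [x] as soon as the last step was
   fresh. *)
have [wN wNE] : exists w : R, w = (last_step (fresh_step co k0) h)%:R * (d`!%:R * (n^-1 * p^-1 ^+ d)).
  by eexists.
apply: le_trans (_ : \sum_x (wN + (steady_retrace co d L k0 h x)%:R +
   c1 * (if good co k0 h x && ~~ costly_step co d k0 h x then label_weight h x else 0) +
   c2 * label_weight h x) <= _).
  apply: ler_sum => x _; rewrite /step_weight.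
  have b0 := label_weight_ge0 h x.
  have wN0 : 0 <= wN by rewrite wNE !mulr_ge0 ?exprn_ge0 ?invr_ge0 // ltW.
  have good0 : ~~ costly_step co d k0 h x -> good co k0 h x.
    by rewrite /costly_step /bad_step !negb_or negbK => /andP[].
  have t3 : 0 <= c1 * (if good co k0 h x && ~~ costly_step co d k0 h x then label_weight h x else 0).
    by rewrite mulr_ge0 //; case: ifP.
  have t4 : 0 <= c2 * label_weight h x by rewrite mulr_ge0.
  have t2 : 0 <= (steady_retrace co d L k0 h x)%:R :> R by [].
  have gb : ~~ costly_step co d k0 h x ->
      (if good co k0 h x && ~~ costly_step co d k0 h x then label_weight h x else 0) = label_weight h x.
    by move=> nc; rewrite nc good0.
  move: t3 gb; set T3 := (if _ then _ else _) => t3 gb.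
  have [qN|qN] := boolP (steady_fresh co L k0 h x).
    have nc := steady_fresh_costly d qN.
    rewrite /cheap_step qN (negbTE nc) /= expr1 !expr0 !mulr1.
    have -> : label_weight h x * d`!%:R = wN.
      rewrite wNE /label_weight; case/and3P: qN => _ -> /andP[us /allP an].
      have -> : new_cols co k0 h x = d; last by rewrite /new_row us mul1r expr1 mulrC.
      transitivity (size (ct x.2)); last by rewrite size_co.
      by apply/eqP; rewrite -all_count; exact/allP.
    by lra.
  have [qR|qR] := boolP (steady_retrace co d L k0 h x).
    have [_ _ kR nc] := and4P qR.
    rewrite /cheap_step qR (negbTE nc) andbF /= !expr0 !mulr1.
    have -> : label_weight h x = 1.
      case/and3P: kR => _ us /hasPn nn; rewrite /label_weight /new_row us expr0 mul1r.
      have -> : new_cols co k0 h x = 0%N; last by rewrite expr0.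
      by apply/eqP; rewrite -leqn0 leqNgt -has_count; apply/hasPn.
    by rewrite mulr1n; move: (c2_ge0); lra.
  rewrite /cheap_step qN qR /= !andbT expr0 mul1r.
  case: (boolP (costly_step co d k0 h x)) => c /=; rewrite ?expr0 ?expr1.
    by rewrite ?mulr1 ?mul1r mulrC; lra.
  by rewrite ?mulr1 mulrC; rewrite gb // in t3 *; lra.
rewrite !big_split /= -!mulr_sumr -big_mkcond /= lerD //; last first.
  by rewrite ler_wpM2l // sum_label_weight.
rewrite lerD //; last by rewrite ler_wpM2l // sum_label_weight_regular.
have sN : \sum_(x : step) wN <= (last_step (fresh_step co k0) h)%:R.
  rewrite sumr_const wNE card_prod -[_ *+ _]mulr_natr -mulrA ler_piMr //.
  have -> : d`!%:R * (n^-1 * p^-1 ^+ d) * (#|I| * #|K|)%:R =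
     (#|K| * d`!)%:R / p ^+ d :> R.
    by rewrite !natrM exprVn; field; rewrite ?expf_neq0 ?gt_eqF.
  by rewrite ler_pdivrMr ?exprn_gt0 // mul1r -natrX ler_nat.
have sR : \sum_x (steady_retrace co d L k0 h x)%:R <= (last_step (retrace_step co k0) h)%:R :> R.
  have [/existsP[x qx]|none] := boolP [exists x, steady_retrace co d L k0 h x]; last first.
    rewrite big1 // => x _; case: (boolP (steady_retrace _ _ _ _ _ _)) => // qx.
    by case/existsP: none; exists x.
  have [_ tx kx cx] := and4P qx; rewrite tx (bigD1 x) //= qx big1 ?addr0 //.
  move=> y yx; case: (boolP (steady_retrace _ _ _ _ _ _)) => // qy.
  have [_ _ ky cy] := and4P qy.
  by case/eqP: yx; apply: (retrace_step_unique co_uniq size_co co_inj d_gt0 ky cy kx cx).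
(* The last step is not both fresh and a retrace, so the two indicators add up to at most 1. *)
apply: le_trans (lerD sN sR) _.
rewrite -natrD lern1; case: (h) => [|y h'] //=.
have : ~~ (fresh_step co k0 h' y && retrace_step co k0 h' y).
  by rewrite /fresh_step /retrace_step; case: (row_seen h' y.1); rewrite ?andbF.
by case: (fresh_step _ _ _ _); case: (retrace_step _ _ _ _).
Qed.

Fixpoint sum_walks (m : nat) (F : hist -> R) : R :=
  if m is m'.+1 then \sum_x sum_walks m' (fun h => F (x :: h)) else F [::].

Lemma ler_sum_walks m F G : (forall h, size h = m -> F h <= G h) -> sum_walks m F <= sum_walks m G.
Proof.
elim: m F G => [|m IH] F G FG /=; first exact: FG.
by apply: ler_sum => x _; apply: IH => h hm; apply: FG; rewrite /= hm.
Qed.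

Lemma sum_walks_exchange m (T : finType) (F : T -> hist -> R) :
  \sum_t sum_walks m (F t) = sum_walks m (fun h => \sum_t F t h).
Proof.
elim: m F => [|m IH] F //=; rewrite exchange_big /=.
by apply: eq_bigr => x _; rewrite IH.
Qed.

Lemma sum_walks_scale m c F : sum_walks m (fun h => c * F h) = c * sum_walks m F.
Proof. by elim: m F => [|m IH] F //=; rewrite mulr_sumr; apply: eq_bigr. Qed.

Lemma sum_history_weight m M b : (m <= M)%N -> 0 <= b ->
  (forall h, (size h < M)%N -> \sum_x step_weight h x <= b) ->
  sum_walks m history_weight <= b ^+ m.
Proof.
move=> mM b0 H; elim: m mM => [|m IH] mM //=.
rewrite sum_walks_exchange; apply: le_trans (_ : sum_walks m (fun h => b * history_weight h) <= _).
  apply: ler_sum_walks => h hm; rewrite -mulr_suml ler_wpM2r ?H ?hm //.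
  elim: (h) => //= x h' IHw; rewrite mulr_ge0 // mulr_ge0 ?label_weight_ge0 //.
  by rewrite !mulr_ge0 ?exprn_ge0.
by rewrite sum_walks_scale exprS ler_wpM2l // IH // ltnW.
Qed.
End Transfer.

(** * Powers of symmetric matrices and of [Tmat] *)

Section SymmetricPowers.
Variables (R : realFieldType) (T : finType) (M : T -> T -> R).
Hypothesis Msym : forall i j, M i j = M j i.
Implicit Types v w : T -> R.

Fixpoint mpow r i j : R :=
  if r is r'.+1 then \sum_k M i k * mpow r' k j else (i == j)%:R.

Definition mx_app v i := \sum_j M i j * v j.
Definition inner v w := \sum_i v i * w i.

Lemma cauchy_schwarz v w : inner v w ^+ 2 <= inner v v * inner w w.
Proof.
rewrite -subr_ge0.
have H : 0 <= \sum_i \sum_j (v i * w j - v j * w i) ^+ 2.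
  by rewrite sumr_ge0 // => i _; rewrite sumr_ge0 // => j _; rewrite sqr_ge0.
have E : \sum_i \sum_j (v i * w j - v j * w i) ^+ 2 =
    2%:R * (inner v v * inner w w - inner v w ^+ 2).
  have pr (a b : T -> R) : \sum_i \sum_j a i * b j = (\sum_i a i) * \sum_j b j.
    by rewrite mulr_suml; apply: eq_bigr => i _; rewrite mulr_sumr.
  have -> : \sum_i \sum_j (v i * w j - v j * w i) ^+ 2 =
      \sum_i \sum_j (v i * v i) * (w j * w j) +
      \sum_i \sum_j (w i * w i) * (v j * v j) -
      2%:R * \sum_i \sum_j (v i * w i) * (v j * w j).
    rewrite mulr_sumr -big_split -sumrB /=; apply: eq_bigr => i _.
    rewrite mulr_sumr -big_split -sumrB /=; apply: eq_bigr => j _; ring.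
  rewrite !pr -/(inner v v) -/(inner w w) -/(inner v w); ring.
by rewrite E pmulr_rge0 ?ltr0n in H.
Qed.

Lemma inner_mx_app v w : inner (mx_app v) w = inner v (mx_app w).
Proof.
rewrite /inner /mx_app.
under eq_bigr do rewrite mulr_suml.
under [RHS]eq_bigr do rewrite mulr_sumr.
rewrite exchange_big; apply: eq_bigr => i _; apply: eq_bigr => j _.
by rewrite Msym; ring.
Qed.

Lemma inner_iter r s v : inner (iter r mx_app v) (iter s mx_app v) = inner v (iter (r + s) mx_app v).
Proof. by elim: r s => // r IH s; rewrite /= inner_mx_app -iterS IH addnS. Qed.

Lemma iter_mx_appE r v i : iter r mx_app v i = \sum_j mpow r i j * v j.
Proof.
elim: r i => [|r IH] i /=.
  rewrite (bigD1 i) //= eqxx mul1r big1 ?addr0 // => j /negbTE.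
  by rewrite eq_sym => ->; rewrite mul0r.
have -> : mx_app (iter r mx_app v) i = \sum_j M i j * iter r mx_app v j by [].
under [LHS]eq_bigr do rewrite IH mulr_sumr.
rewrite exchange_big; apply: eq_bigr => j _ /=; rewrite mulr_suml.
by apply: eq_bigr => k _; rewrite mulrA.
Qed.

Lemma mpow_add r s i j : mpow (r + s) i j = \sum_k mpow r i k * mpow s k j.
Proof.
elim: r i => [|r IH] i /=.
  rewrite (bigD1 i) //= eqxx mul1r big1 ?addr0 // => k /negbTE.
  by rewrite eq_sym => ->; rewrite mul0r.
under [LHS]eq_bigr do rewrite IH mulr_sumr.
rewrite exchange_big; apply: eq_bigr => k _ /=; rewrite mulr_suml.
by apply: eq_bigr => l _; rewrite mulrA.
Qed.

Lemma mpowSr r i j : mpow r.+1 i j = \sum_k mpow r i k * M k j.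
Proof.
rewrite -addn1 mpow_add; apply: eq_bigr => k _; congr (_ * _).
rewrite /= (bigD1 j) //= eqxx mulr1 big1 ?addr0 // => l /negbTE ->.
by rewrite mulr0.
Qed.

Lemma mpow_sym r i j : mpow r i j = mpow r j i.
Proof.
elim: r i j => [|r IH] i j; first by rewrite /= eq_sym.
by rewrite mpowSr; apply: eq_bigr => k _; rewrite Msym IH mulrC.
Qed.

(** By symmetry $|M^rv|^2=\langle v,M^{2r}v\rangle$, so the Cauchy-Schwarz inequality gives
    $|M^rv|^4\le|M^{2r}v|^2$, which is iterated without any spectral theory. At the end $|M^rv|^2$
    is at most the squared Hilbert-Schmidt norm of $M^r$, which is $\mathrm{tr}\,M^{2r}$. *)
Lemma norm_mx_app_trace q v : inner v v <= 1 ->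
  inner (mx_app v) (mx_app v) ^+ (2 ^ q) <= \sum_i mpow (2 * 2 ^ q) i i.
Proof.
move=> v1; have dge0 w : 0 <= inner w w.
  by rewrite sumr_ge0 // => i _; rewrite -expr2 sqr_ge0.
apply: le_trans (_ : inner (iter (2 ^ q) mx_app v) (iter (2 ^ q) mx_app v) <= _).
  elim: q => [|q IH]; first by rewrite expr1.
  rewrite expnSr exprM; apply: le_trans (_ : inner (iter (2 ^ q) mx_app v) (iter (2 ^ q) mx_app v) ^+ 2 <= _).
    by rewrite lerXn2r ?nnegrE ?exprn_ge0.
  rewrite !inner_iter; apply: le_trans (cauchy_schwarz _ _) _.
  have -> : (2 ^ q + 2 ^ q = 2 ^ q * 2)%N by rewrite muln2 addnn.
  rewrite inner_iter; apply: le_trans (_ : 1 * inner v (iter (2 ^ q * 2 + 2 ^ q * 2) mx_app v) <= _).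
    by rewrite ler_wpM2r // -inner_iter.
  by rewrite mul1r.
rewrite mul2n -addnn; under [leRHS]eq_bigr do rewrite mpow_add.
apply: ler_sum => i _; rewrite -expr2 iter_mx_appE.
apply: le_trans (cauchy_schwarz _ _) _.
apply: le_trans (_ : inner (mpow (2 ^ q) i) (mpow (2 ^ q) i) * 1 <= _).
  by rewrite ler_wpM2l.
rewrite mulr1; apply: ler_sum => k _.
by rewrite (mpow_sym (2 ^ q) k i).
Qed.

End SymmetricPowers.

Section WalkSums.
Variables (R : realFieldType) (I A K : finType) (d : nat) (ct : K -> d.-tuple A)
  (x : I -> A -> R).
Notation co := (fun k => tval (ct k)).
Hypothesis co_uniq : forall k, uniq (ct k).
Let step := (I * K)%type.
Let hist := seq step.

Definition rowprod u k := \prod_(s < d) x u (tnth (ct k) s).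

Fixpoint walk_weight k0 (h : hist) : R :=
  if h is y :: h' then rowprod y.1 y.2 * rowprod y.1 (current k0 h') * walk_weight k0 h' else 1.

Lemma rowprodE u k : rowprod u k = \prod_a x u a ^+ (a \in ct k).
Proof.
rewrite /rowprod -(big_tuple _ _ (ct k) predT (x u)) /=.
rewrite big_uniq ?co_uniq // big_mkcond; apply: eq_bigr => a _.
by case: (a \in _); rewrite ?expr1 ?expr0.
Qed.

Lemma walk_weightE k0 h : walk_weight k0 h = \prod_u \prod_a x u a ^+ edge_mult co k0 h u a.
Proof.
elim: h => [|y h IH] /=.
  by rewrite big1 // => u _; rewrite big1 // => a _; rewrite expr0.
rewrite IH (bigD1 y.1) //= [RHS](bigD1 y.1) //=.
rewrite mulrA; congr (_ * _); last first.
  by apply: eq_bigr => u /negbTE uy; under [RHS]eq_bigr do rewrite uy mul0n add0n.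
rewrite !rowprodE -!big_split /=; apply: eq_bigr => a _.
by rewrite eqxx mul1n !exprD.
Qed.

Lemma current_cat k0 (h1 h2 : hist) : current k0 (h1 ++ h2) = current (current k0 h2) h1 :> K.
Proof. by case: h1. Qed.

Lemma walk_weight_cat k0 h1 h2 : walk_weight k0 (h1 ++ h2) = walk_weight (current k0 h2) h1 * walk_weight k0 h2.
Proof. by elim: h1 => [|y h1 IH] /=; rewrite ?mul1r // IH current_cat mulrA. Qed.

(** At a multiple of [L] no condition links the rows on the two sides, so walks of several blocks
    are free concatenations. This turns products of matrices into sums over walks. *)
Lemma nonbacktracking_cat L k0 (h1 h2 : hist) : (L %| size h2)%N ->
  nonbacktracking L k0 (h1 ++ h2) = nonbacktracking L (current k0 h2) h1 && nonbacktracking L k0 h2.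
Proof.
move=> Lh; elim: h1 => [|y h1 IH] //=.
rewrite IH current_cat !andbA; congr (_ && _ && _ && _).
rewrite /block_end size_cat dvdn_addl //.
by case: h1 {IH} => [|z h1] //=; rewrite dvdn0.
Qed.

Lemma sum_walks_cat m1 m2 (F : hist -> R) :
  sum_walks (m1 + m2) F = sum_walks m1 (fun h1 => sum_walks m2 (fun h2 => F (h1 ++ h2))).
Proof. by elim: m1 F => [|m1 IH] F //=; apply: eq_bigr => y _; rewrite IH. Qed.

Lemma eq_sum_walks m (F G : hist -> R) : (forall h, size h = m -> F h = G h) ->
  sum_walks m F = sum_walks m G.
Proof.
elim: m F G => [|m IH] F G FG /=; first exact: FG.
by apply: eq_bigr => y _; apply: IH => h hm; apply: FG; rewrite /= hm.
Qed.

Definition walks L r j i :=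
  sum_walks (r * L) (fun h => (nonbacktracking L j h && (current j h == i))%:R * walk_weight j h).

Lemma walks_pow L r i j :
  mpow (fun i j => walks L 1 j i) r i j = walks L r j i.
Proof.
elim: r i => [|r IH] i; first by rewrite /walks /= mulr1 eq_sym.
rewrite [RHS]/walks mulSn sum_walks_cat /=.
under [LHS]eq_bigr do rewrite IH [walks L 1 _ _]/walks mul1n mulrC -sum_walks_scale.
rewrite sum_walks_exchange; apply: eq_sum_walks => h1 _.
under [LHS]eq_bigr do rewrite mulrC [walks L r _ _]/walks -sum_walks_scale.
rewrite sum_walks_exchange; apply: eq_sum_walks => h2 sh2.
rewrite nonbacktracking_cat ?sh2 ?dvdn_mull // current_cat walk_weight_cat.
rewrite (bigD1 (current j h2)) //= eqxx big1 ?addr0; last first.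
  by move=> k /negbTE; rewrite eq_sym => ->; rewrite andbF mul0r mulr0.
rewrite andbT; case: (nonbacktracking L j h2); case: (nonbacktracking L _ h1); rewrite /= ?mul0r ?mulr0 // ?mul1r.
by rewrite mulrA.
Qed.

End WalkSums.

Section Increasing.
Variables (d p : nat).
Definition incr_tuple (k : incr d p) : d.-tuple 'I_p := val k.

Lemma incr_tuple_uniq k : uniq (incr_tuple k).
Proof.
apply: (@sorted_uniq _ (fun a b : 'I_p => (a < b)%N)); last exact: (valP k).
- by move=> a b c; apply: ltn_trans.
- by move=> a; rewrite ltnn.
Qed.

Lemma incr_tuple_inj k k' : {subset incr_tuple k <= incr_tuple k'} -> k = k'.
Proof.
move=> sub; apply/val_inj/val_inj.
have sz : (size (incr_tuple k') <= size (incr_tuple k))%N by rewrite !size_tuple.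
have [_ eqm] := uniq_min_size (incr_tuple_uniq k) sub sz.
apply: (@irr_sorted_eq _ (fun a b : 'I_p => (a < b)%N)).
- by move=> a b c; apply: ltn_trans.
- by move=> a; rewrite ltnn.
- exact: (valP k).
- exact: (valP k').
- exact: eqm.
Qed.

Lemma card_incr : #|{: incr d p}| = 'C(p, d).
Proof.
rewrite -card_ltn_sorted_tuples card_sig cardsE; apply: eq_card => t.
by rewrite !inE [RHS]unfold_in sorted_map.
Qed.

Lemma card_incr_fact : (#|{: incr d p}| * d`! <= p ^ d)%N.
Proof.
rewrite card_incr bin_ffact; elim: d p => [|e IH] q //.
case: q => [|q]; first by rewrite ffact0n.
rewrite ffactSS expnS leq_mul2l /=; apply: leq_trans (IH q) _.
by rewrite leq_expn_base.
Qed.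

End Increasing.

Section TupleSums.
Variables (R : realFieldType) (I A K : finType) (d : nat) (ct : K -> d.-tuple A)
  (x : I -> A -> R).
Notation co := (fun k => tval (ct k)).
Notation step := (I * K)%type.

Lemma sum_walks_tuple m (F : seq step -> R) : sum_walks m F = \sum_(t : m.-tuple step) F t.
Proof.
elim: m F => [|m IH] F /=.
  by rewrite (big_pred1 [tuple]) // => t; rewrite [t]tuple0; apply/esym/eqP.
rewrite (reindex (fun yt : step * m.-tuple step => [tuple of yt.1 :: yt.2])) /=; last first.
  exists (fun t => (thead t, [tuple of behead t])) => [[y t] _|t _] /=.
    by congr pair; apply/val_inj.
  by rewrite [RHS]tuple_eta; apply/val_inj.
by under eq_bigr do rewrite IH; rewrite pair_bigA.
Qed.

(** In a walk of at most [L] steps only the first step starts at a block end. The default value [k0]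
    of [nth] is the starting tuple, met at index [size h]. *)
Lemma nonbacktrackingP L k0 y0 (h : seq step) : (size h <= L)%N ->
  reflect ((forall r, r < size h ->
              nth k0 (map snd h) r != nth k0 (map snd h) r.+1)%N /\
           (forall r, r.+1 < size h -> (nth y0 h r).1 != (nth y0 h r.+1).1)%N)
    (nonbacktracking L k0 h).
Proof.
elim: h => [|y h IH] hL; first by left; split.
have c0 : current k0 h = nth k0 (map snd h) 0 by case: (h).
have ex : block_end L h = (size h == 0%N).
  rewrite /block_end; case: (size h) (hL : (size h < L)%N) => [|s] hs; first by rewrite dvdn0.
  by rewrite gtnNdvd.
rewrite /= ex c0; apply: (iffP and3P).
  move=> [h1 h2 /(IH (ltnW hL))[h3 h4]]; split; case=> [|r] //=; [exact: h3| |exact: h4].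
  by case: (h) h2.
move=> [h1 h2]; split.
- exact: (h1 0%N).
- case: (h) h2 => [|z h'] //= h2; exact: (h2 0%N).
- apply/(IH (ltnW hL)); split => r hr; first exact: (h1 r.+1).
  exact: (h2 r.+1).
Qed.

Lemma walk_weight_nth k0 y0 (h : seq step) : walk_weight ct x k0 h =
  \prod_(r < size h) (rowprod ct x (nth y0 h r).1 (nth k0 (map snd h) r) *
                      rowprod ct x (nth y0 h r).1 (nth k0 (map snd h) r.+1)).
Proof.
elim: h => [|y h IH]; first by rewrite big_ord0.
rewrite /= big_ord_recl /= IH; congr (_ * _ * _).
by case: (h).
Qed.

End TupleSums.

Section TmatWalks.
Variables (R : realType) (n p d L : nat) (X : 'I_n -> 'I_p -> R).
Hypothesis L_gt0 : (0 < L)%N.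
Notation ct := (@incr_tuple d p).

Definition Tmat_factor : R :=
  Num.sqrt d`!%:R ^+ L / Num.sqrt (n%:R ^+ L * p%:R ^+ (d * L)).

(* The walks are read from [k^(L) = j] to [k^(0) = i]. *)
Lemma Tmat_walks i j : Tmat L X i j = Tmat_factor * walks ct X L 1 j i.
Proof.
rewrite /Tmat -[L == 0%N]negbK -lt0n L_gt0 /= -/Tmat_factor; congr (_ * _).
rewrite /walks mul1n sum_walks_tuple.
(* The default [j] provides the value of [k] at index [L]. *)
pose phi (t : L.-tuple ('I_n * incr d p)) :
   {ffun 'I_L -> 'I_n} * {ffun 'I_L.+1 -> incr d p} :=
  ([ffun r => (tnth t r).1], [ffun r : 'I_L.+1 => nth j (map snd t) r]).
pose psi (uk : {ffun 'I_L -> 'I_n} * {ffun 'I_L.+1 -> incr d p}) :=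
  [tuple (uk.1 r, uk.2 (inord r)) | r < L].
rewrite pair_big_dep /= (reindex_onto phi psi) /=; last first.
  move=> [u k] /= /and4P[_ _ /eqP kj _]; congr pair; apply/ffunP => r.
    by rewrite ffunE tnth_mktuple.
  rewrite ffunE; have [rL|rL] := ltnP r L.
    rewrite (nth_map (u (Ordinal rL), j)) ?size_tuple //.
    rewrite -(tnth_nth _ _ (Ordinal rL)) tnth_mktuple /=.
    by congr (k _); apply/val_inj; rewrite /= inordK.
  have sz : (size (map snd (psi (u, k))) <= r)%N by rewrite size_map size_tuple.
  rewrite (nth_default _ sz); transitivity (k ord_max); [exact: esym|congr (k _)].
  by apply/val_inj; apply/eqP; rewrite eqn_leq rL -ltnS ltn_ord.
rewrite big_mkcond [RHS](eq_bigr (fun t : L.-tuple _ =>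
  if nonbacktracking L j t && (current j t == i) then walk_weight ct X j t else 0)); last first.
  by move=> t _; case: ifP; rewrite ?mul1r ?mul0r.
apply: eq_bigr => t _; pose y0 := tnth t (Ordinal L_gt0).
have kE r : (r <= L)%N -> (phi t).2 (inord r) = nth j (map snd t) r.
  by move=> rL; rewrite ffunE inordK.
have uE (r : 'I_L) : (phi t).1 r = (nth y0 t r).1 by rewrite ffunE (tnth_nth y0).
have -> : psi (phi t) == t.
  apply/eqP/eq_from_tnth => r; rewrite tnth_mktuple kE 1?ltnW // uE.
  rewrite (tnth_nth y0) (nth_map y0) ?size_tuple //.
  by case: (nth y0 t r).
rewrite andbT; congr (if _ then _ else _).
  apply/idP/idP.
    move=> /and4P[/forallP h1 /eqP h2 _ /forallP h3]; apply/andP; split; last first.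
      rewrite -h2 -[ord0]inord_val kE //; case: (t) => -[|z s] //= _.
    apply/(nonbacktrackingP j y0); first by rewrite size_tuple.
    rewrite size_tuple; split => r rL.
      by have := h3 (Ordinal rL); rewrite !kE // ltnW.
    have /forallP/(_ (Ordinal rL)) := h1 (Ordinal (ltnW rL)).
    by rewrite eqxx /= !uE.
  move=> /andP[/(nonbacktrackingP j y0)]; rewrite size_tuple => /(_ (leqnn _))[h1 h2] ci.
  apply/and4P; split.
  - apply/forallP => r1; apply/forallP => r2; apply/implyP => /eqP e.
    by rewrite !uE e h2 // -e.
  - move: ci; rewrite -[ord0]inord_val kE //; by case: (t) => -[|z s].
  - rewrite -[ord_max]inord_val kE // nth_default // size_map size_tuple //.
  - by apply/forallP => r; rewrite !kE ?h1 // ltnW.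
rewrite (walk_weight_nth ct X j y0) size_tuple exchange_big /=.
apply: eq_bigr => r _; rewrite big_split /=.
rewrite -uE; congr (_ * _); apply: eq_bigr => s _; rewrite kE //.
by rewrite ltnW.
Qed.

(** Reversing [u] and [k] exchanges the two end conditions and permutes the factors of each
    product. *)
Lemma Tmat_sym (i j : incr d p) : Tmat L X i j = Tmat L X j i.
Proof.
rewrite /Tmat (eq_sym i j); case: (L == 0%N) => //; congr (_ * _).
have rinj m : injective (@rev_ord m) by apply: can_inj (@rev_ordK m).
pose ru (u : {ffun 'I_L -> 'I_n}) := [ffun r => u (rev_ord r)].
pose rk (k : {ffun 'I_L.+1 -> incr d p}) := [ffun r => k (rev_ord r)].
have ruK : involutive ru by move=> u; apply/ffunP => r; rewrite !ffunE rev_ordK.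
have rkK : involutive rk by move=> k; apply/ffunP => r; rewrite !ffunE rev_ordK.
have rev_in r : (r <= L)%N -> rev_ord (inord r : 'I_L.+1) = inord (L - r).
  by move=> rL; apply/val_inj; rewrite /= !inordK ?subSS // ltnS leq_subr.
rewrite (reindex_inj (inv_inj ruK)) /=; apply: eq_big => [u|u _].
  apply/forallP/forallP => H r1; apply/forallP => r2; apply/implyP => /eqP e.
    have /forallP/(_ (rev_ord r1)) := H (rev_ord r2).
    rewrite !ffunE !rev_ordK => /implyP h; rewrite eq_sym; apply: h; apply/eqP => /=.
    by rewrite e; have := ltn_ord r2; rewrite e => ?; rewrite subnSK.
  have /forallP/(_ (rev_ord r1)) := H (rev_ord r2).
  rewrite !ffunE => /implyP h; rewrite eq_sym; apply: h; apply/eqP => /=.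
  by rewrite e; have := ltn_ord r2; rewrite e => ?; rewrite subnSK.
rewrite (reindex_inj (inv_inj rkK)) /=; apply: eq_big => [k|k _].
  have r0 : rev_ord ord0 = ord_max :> 'I_L.+1 by apply/val_inj; rewrite /= subn1.
  have rm : rev_ord ord_max = ord0 :> 'I_L.+1 by apply/val_inj; rewrite /= subnn.
  rewrite !ffunE r0 rm andbCA; congr [&& _, _ & _].
  have e r : (rk k (inord (r : 'I_L)) != rk k (inord r.+1)) =
      (k (inord (rev_ord r)) != k (inord (rev_ord r).+1)).
    by rewrite !ffunE (rev_in r (ltnW (ltn_ord r))) (rev_in r.+1 (ltn_ord r)) eq_sym /= subnSK.
  apply/forallP/forallP => H r; last by rewrite e H.
  by have := H (rev_ord r); rewrite e rev_ordK.
apply: eq_bigr => s _; rewrite [RHS](reindex_inj (rinj L)) /=.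
apply: eq_bigr => r _; rewrite mulrC !ffunE.
rewrite (rev_in r (ltnW (ltn_ord r))) (rev_in r.+1 (ltn_ord r)).
by rewrite subnSK.
Qed.

End TmatWalks.

(** * The moment bound *)

Lemma spec_norm_le (R : realType) (T : finType) (M : T -> T -> R) q (b : R) :
  (forall i j, M i j = M j i) -> 0 <= b ->
  \sum_i mpow M (2 * 2 ^ q) i i <= b ^+ (2 ^ q) ->
  spec_norm M <= Num.sqrt b.
Proof.
move=> Msym b0 Mb; apply: ge_sup.
  exists 0; exists (fun=> 0); first by rewrite /= big1 // => i _; rewrite expr0n.
  rewrite big1 ?sqrtr0 // => i _; rewrite big1 ?expr0n // => j _; exact: mulr0.
move=> _ [v /= v1 <-]; rewrite ler_sqrt //.
have dotE w : \sum_i w i ^+ 2 = inner w w by apply: eq_bigr => i _; rewrite expr2.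
have {}v1 : inner v v <= 1 by rewrite -dotE.
have := le_trans (norm_mx_app_trace Msym q v1) Mb.
rewrite ler_pXn2r ?nnegrE ?expn_gt0 ?dotE //.
by rewrite sumr_ge0 // => i _; rewrite -expr2 sqr_ge0.
Qed.

Lemma ratio_bound (R : realFieldType) (b n p D a1 a2 Q U V ch cs q h0 d s : nat) :
  (0 < n)%N -> (0 < p)%N -> (0 < D)%N -> (0 < a1)%N -> (0 < a2)%N ->
  (b * (n ^ U * p ^ V) * (a1 ^ ch * a2 ^ cs) * D ^ h0 <=
   n ^ h0 * p ^ (d * h0) * Q ^ s * D ^ q)%N ->
  b%:R <= Q%:R ^+ s * (n%:R * p%:R ^+ d / D%:R) ^+ h0 *
    (n%:R^-1 ^+ U * p%:R^-1 ^+ V *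
      (D%:R ^+ q * a1%:R^-1 ^+ ch * a2%:R^-1 ^+ cs)) :> R.
Proof.
move=> n0 p0 D0 a10 a20; rewrite -(ler_nat R) !natrM !natrX => H.
have pos m k : (0 < m)%N -> 0 < m%:R ^+ k :> R by move=> m0; rewrite exprn_gt0 // ltr0n.
rewrite expr_div_n exprMn -exprM !exprVn.
have -> : Q%:R ^+ s * (n%:R ^+ h0 * p%:R ^+ (d * h0) / D%:R ^+ h0) *
   ((n%:R ^+ U)^-1 / p%:R ^+ V * (D%:R ^+ q / a1%:R ^+ ch / a2%:R ^+ cs)) =
  (n%:R ^+ h0 * p%:R ^+ (d * h0) * Q%:R ^+ s * D%:R ^+ q) /
  ((n%:R ^+ U * p%:R ^+ V) * (a1%:R ^+ ch * a2%:R ^+ cs) * D%:R ^+ h0) :> R.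
  by rewrite !invfM; ring.
by rewrite ler_pdivlMr ?mulrA -?mulrA // ?mulr_gt0 ?pos // !mulrA in H *.
Qed.

Section MomentSum.
Variables (R : realFieldType) (n p d L s C0 B0 : nat).
Hypotheses (d_gt0 : (0 < d)%N) (L_gt0 : (0 < L)%N) (s_gt0 : (0 < s)%N)
  (n_gt0 : (0 < n)%N) (p_gt0 : (0 < p)%N) (C0_gt0 : (0 < C0)%N) (B0_gt0 : (0 < B0)%N)
  (pdn : (p ^ d <= C0 * n)%N).
Notation ct := (@incr_tuple d p).
Notation co := (fun k => tval (ct k)).
Notation step := ('I_n * incr d p)%type.
Notation K1 := (2 * (1 + 2 * d) ^ d)%N.
Notation M := (2 * s * L)%N.
Notation M1 := ((1 + M) * (1 + d * M) ^ d)%N.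
(** The price of a cheap step: [L * K1] is the inverse of its weight [c1], and [d! * C0] pays for
    one steady fresh step missing among [s * L]. *)
Definition growth_const := (L * K1 * d`! * C0)%N.
Hypothesis big_p : (B0 ^ 2 * growth_const ^ 16 *
  (L * M1 * d`! * C0) ^ (2 * (1 + 5 * d)) * (d`! * C0) <= p)%N.

Definition validb k0 (h : seq step) := [forall u, forall a, edge_mult co k0 h u a != 1%N].

Definition excess k0 (h : seq step) := (\sum_u \sum_a (edge_mult co k0 h u a - 2))%N.

Lemma moment_sum :
  \sum_i sum_walks (2 * s * L) (fun h : seq step =>
     (nonbacktracking L i h && validb i h)%:R * B0%:R ^+ excess i h) <=
  p%:R ^+ d * (1 + 2%:R / L%:R) ^+ (2 * s * L) * (growth_const ^ 21)%:R ^+ s *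
    (n%:R * p%:R ^+ d / d`!%:R) ^+ (s * L) :> R.
Proof.
(* Chosen such that the last two terms in [sum_step_weight] are $1/L$ each. *)
pose c1 : R := (L * K1)%:R^-1; pose c2 : R := (L * M1)%:R^-1.
have K10 : (0 < K1)%N by rewrite muln_gt0 expn_gt0.
have M10 : (0 < M1)%N by rewrite muln_gt0 expn_gt0.
have nR : 0 < n%:R :> R by rewrite ltr0n.
have pR : 0 < p%:R :> R by rewrite ltr0n.
have DR : 0 < d`!%:R :> R by rewrite ltr0n fact_gt0.
have c10 : 0 < c1 by rewrite invr_gt0 ltr0n muln_gt0 L_gt0.
have c20 : 0 < c2 by rewrite invr_gt0 ltr0n muln_gt0 L_gt0.
have size_co k : size (ct k) = d by rewrite size_tuple.
have cI : (0 < #|{: 'I_n}|)%N by rewrite card_ord.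
have cA : (0 < #|{: 'I_p}|)%N by rewrite card_ord.
have cK : (#|{: incr d p}| * d`! <= #|{: 'I_p}| ^ d)%N by rewrite card_ord card_incr_fact.
pose G : R := (growth_const ^ 21)%:R ^+ s * (n%:R * p%:R ^+ d / d`!%:R) ^+ (s * L).
have G0 : 0 <= G by rewrite mulr_ge0 ?exprn_ge0 // !mulr_ge0 ?exprn_ge0 ?invr_ge0 // ltW.
pose w (i : incr d p) : seq step -> R := history_weight L ct i c1 c2.
have pw i h : size h = M -> (nonbacktracking L i h && validb i h)%:R * B0%:R ^+ excess i h <= G * w i h.
  move=> hM; have w0 : 0 <= w i h.
    elim: (h) => //= y h' IH; rewrite mulr_ge0 //.
    by rewrite /step_weight /label_weight !mulr_ge0 ?exprn_ge0 ?invr_ge0 // ltW.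
  case: (boolP (nonbacktracking L i h)) => nb; last by rewrite mul0r mulr_ge0.
  case: (boolP (validb i h)) => v; last by rewrite mul0r mulr_ge0.
  have {}v : valid co i h by move=> u a; move/forallP/(_ u)/forallP/(_ a): v.
  have := label_count_le (@incr_tuple_uniq d p) size_co (@incr_tuple_inj d p) d_gt0 L_gt0 p_gt0 C0_gt0 B0_gt0 M10 s_gt0
    pdn nb v hM big_p.
  rewrite -/growth_const -/(excess i h) mul1r /w history_weightE !card_ord -natrX => H.
  by apply: ratio_bound H; rewrite ?fact_gt0 // muln_gt0 L_gt0.
apply: le_trans (_ : \sum_i G * sum_walks M (w i) <= _).
  apply: ler_sum => i _; rewrite -sum_walks_scale; apply: ler_sum_walks => h hM; exact: pw.
have ws i : sum_walks M (w i) <= (1 + 2%:R / L%:R) ^+ M.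
  apply: (sum_history_weight (ltW c10) (ltW c20) (leqnn M)).
    by rewrite addr_ge0 // mulr_ge0 // invr_ge0.
  move=> h hM; have T1 := (sum_step_weight L i (@incr_tuple_uniq d p) (@incr_tuple_inj d p) d_gt0 cI cA cK (ltW c10) (ltW c20) hM); apply: le_trans T1 _.
  have L0 : 0 < L%:R :> R by rewrite ltr0n.
  have e1 : c1 * K1%:R = L%:R^-1.
    by rewrite /c1 [(L * _)%:R]natrM invfM -mulrA mulVf ?mulr1 // pnatr_eq0 -lt0n.
  have e2 : c2 * ((1 + M%:R) * (1 + (d * M)%:R) ^+ d) = L%:R^-1.
    have -> : (1 + M%:R) * (1 + (d * M)%:R) ^+ d = M1%:R :> R.
      by rewrite [RHS]natrM natrX !natrD.
    by rewrite /c2 [(L * _)%:R]natrM invfM -mulrA mulVf ?mulr1 // pnatr_eq0 -lt0n.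
  by rewrite e1 e2 -addrA lerD2l mulr2n mulrDl mul1r.
apply: le_trans (_ : \sum_(i : incr d p) G * (1 + 2%:R / L%:R) ^+ M <= _).
  by apply: ler_sum => i _; rewrite ler_wpM2l.
rewrite sumr_const -[_ *+ _]mulr_natr.
have cKR : #|{: incr d p}|%:R <= p%:R ^+ d :> R.
  rewrite -natrX ler_nat -[p in (_ <= p ^ d)%N]card_ord.
  by apply: leq_trans cK; rewrite leq_pmulr // fact_gt0.
have W0 : 0 <= (1 + 2%:R / L%:R) ^+ M :> R.
  by rewrite exprn_ge0 // addr_ge0 // mulr_ge0 // invr_ge0.
rewrite -[leRHS]mulrA -/G mulrC -[leRHS]mulrA [X in _ <= _ * X]mulrC.
by rewrite ler_wpM2r // mulr_ge0.
Qed.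

End MomentSum.

Local Open Scope classical_set_scope.

(** * Independence *)

Section Independence.
Context dT (T : measurableType dT) (R : realType) (P : probability T R).

Import HBNNSimple.

(* The sets [A] and [V], levels and values of simple approximations of [f], do
   not depend on the weight [g]. *)
Lemma integral_simple_limit (Y : T -> R) (f : R -> R) :
  measurable_fun setT Y -> measurable_fun setT f -> (forall y, 0 <= f y) ->
  exists (A : nat -> R -> set R) (V : nat -> set R),
    (forall n k, measurable (A n k)) /\
    forall g : T -> R, measurable_fun setT g -> (forall w, 0 <= g w) ->
    (\int[P]_w (g w * f (Y w))%:E =
     limn (fun n => \sum_(k \in V n) (k%:E * \int[P]_w (g w * \1_(A n k) (Y w))%:E)))%E.
Proof.
move=> mY mf f0.
have /measurable_EFinP mEf := mf.
pose f_ := nnsfun_approx measurableT mEf.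
have mfY n : measurable_fun setT (fun w => f_ n (Y w)).
  by apply: measurableT_comp mY; exact: measurable_funP.
exists (fun n k => f_ n @^-1` [set k]), (fun n => range (f_ n)); split.
  by move=> n k; rewrite -[X in measurable X]setTI; apply: measurable_funP.
move=> g mg g0.
transitivity (limn (fun n => \int[P]_w (g w * f_ n (Y w))%:E))%E.
  rewrite -monotone_convergence//.
  - apply: eq_integral => w _; apply/esym/cvg_lim => //.
    have H : (f_ n (Y w))%:E @[n --> \oo] --> (f (Y w))%:E.
      by apply: cvg_nnsfun_approx => // y _; rewrite lee_fin.
    under eq_fun do rewrite EFinM.
    by rewrite EFinM; apply: cvgeMl H.
  - by move=> n; apply/measurable_EFinP; apply: measurable_funM.
  - by move=> n w _; rewrite lee_fin mulr_ge0.
  - move=> w _ m n mn; rewrite lee_fin ler_wpM2l //.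
    exact/lefP/nd_nnsfun_approx.
congr (limn _); apply/funext => n.
have mA k : measurable_fun setT (fun w => \1_(f_ n @^-1` [set k]) (Y w) : R).
  apply: measurableT_comp mY; apply: measurable_indic.
  by rewrite -[X in measurable X]setTI; apply: measurable_funP.
transitivity (\int[P]_w (\sum_(k \in range (f_ n)) (k * (g w * \1_(f_ n @^-1` [set k]) (Y w)))%:E))%E.
  apply: eq_integral => w _; rewrite fsumEFin //; congr EFin.
  rewrite [in LHS](fimfunE (f_ n)) mulr_fsumr.
  by apply: eq_fsbigr => k _; rewrite mulrCA.
rewrite ge0_integral_fsum//; last 2 first.
- move=> k; apply/measurable_EFinP; apply: measurable_funM => //.
  exact: measurable_funM.
- move=> k w _; rewrite lee_fin mulrCA mulr_ge0 //.
  by rewrite -lee_fin EFinM nnfun_muleindic_ge0.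
apply: eq_fsbigr => k; rewrite inE => -[y _ <-].
under eq_integral do rewrite EFinM.
rewrite ge0_integralZl_EFin//.
- by move=> w _; rewrite lee_fin mulr_ge0.
- by apply/measurable_EFinP; apply: measurable_funM.
Qed.

Lemma eq_integral_weight (g1 g2 Y : T -> R) (f : R -> R) :
  measurable_fun setT g1 -> measurable_fun setT g2 ->
  measurable_fun setT Y -> measurable_fun setT f ->
  (forall w, 0 <= g1 w) -> (forall w, 0 <= g2 w) -> (forall y, 0 <= f y) ->
  (forall B, measurable B ->
    \int[P]_w (g1 w * \1_B (Y w))%:E = \int[P]_w (g2 w * \1_B (Y w))%:E)%E ->
  (\int[P]_w (g1 w * f (Y w))%:E = \int[P]_w (g2 w * f (Y w))%:E)%E.
Proof.
move=> mg1 mg2 mY mf g10 g20 f0 H.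
have [A [V [mA E]]] := integral_simple_limit mY mf f0.
rewrite !E //; congr (limn _); apply/funext => n; apply: eq_fsbigr => k _.
by rewrite H.
Qed.

Section Family.
Variables (J : finType) (Y : J -> T -> R).
Hypothesis mY : forall j, measurable_fun setT (Y j).
Hypothesis Yind : mutually_independent P Y.

Lemma prod_indic (I : Type) (r : seq I) (Q : pred I) (A : I -> set T) w :
  \prod_(i <- r | Q i) \1_(A i) w = \1_(\big[setI/setT]_(i <- r | Q i) A i) w :> R.
Proof.
apply: (big_rec2 (fun a B => a = \1_B w)); first by rewrite indicT.
by move=> i a B _ ->; rewrite indicI.
Qed.

Lemma measurable_prod_fun (F : J -> R -> R) (Q : pred J) :
  (forall j, measurable_fun setT (F j)) ->
  measurable_fun setT (fun w => \prod_(j | Q j) F j (Y j w)).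
Proof.
move=> mF; rewrite (_ : (fun w => _) = fun w => \prod_(j <- index_enum J) 
   (fun j w => if Q j then F j (Y j w) else 1) j w); last first.
  by apply/funext => w; rewrite big_mkcond.
elim: (index_enum J) => [|j s IH].
  by under eq_fun do rewrite big_nil; exact: measurable_cst.
under eq_fun do rewrite big_cons.
apply: measurable_funM => //; case: (Q j); last exact: measurable_cst.
exact: measurableT_comp (mF j) (mY j).
Qed.

(** Induction on the list of coordinates at which [F] need not be an indicator; without any, this is
    the independence of events. To free [j0], the product over the other coordinates and the
    constant equal to its expected value are compared as weights in [eq_integral_weight]: on events
    [B] of [Y j0] they agree by the induction hypothesis. *)
Lemma indep_prod_ge0 (F : J -> R -> R) (e : J -> R) :
  (forall j, measurable_fun setT (F j)) -> (forall j y, 0 <= F j y) ->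
  (forall j, \int[P]_w (F j (Y j w))%:E = (e j)%:E)%E ->
  (\int[P]_w (\prod_j F j (Y j w))%:E = (\prod_j e j)%:E)%E.
Proof.
have : forall j, j \notin enum J -> exists2 B : set R, measurable B & F j = \1_B.
  by move=> j; rewrite mem_enum.
elim: (enum J) F e => [|j0 s IH] F e sB mF F0 eF.
  have /choice[B HB] : forall j, exists B : set R, measurable B /\ F j = \1_B.
    by move=> j; have [//|B] := sB j; exists B.
  have mB j : measurable (B j) by have [] := HB j.
  have mYB j : measurable (Y j @^-1` B j).
    by rewrite -[X in measurable X]setTI; apply: mY.
  have eE j : P (Y j @^-1` B j) = (e j)%:E.
    transitivity (\int[P]_w (\1_(Y j @^-1` B j) w)%:E)%E.
      by rewrite integral_indic // setIT.
    by rewrite -eF; apply: eq_integral => w _; rewrite (proj2 (HB j)).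
  transitivity (P (\big[setI/setT]_j (Y j @^-1` B j))).
    transitivity (\int[P]_w (\1_(\big[setI/setT]_j (Y j @^-1` B j)) w)%:E)%E.
      apply: eq_integral => w _; rewrite -prod_indic.
      by congr EFin; apply: eq_bigr => j _; rewrite (proj2 (HB j)).
    by rewrite integral_indic ?setIT //; apply: bigsetI_measurable.
  have inT j : (j \in finset.setTfor J) = true by exact: finset.in_setT.
  transitivity (P (\big[setI/setT]_(j in finset.setTfor J) (Y j @^-1` B j))).
    by congr (P _); apply: eq_bigl => j; rewrite inT.
  rewrite Yind // -prodEFin; apply: eq_big => j; first exact: inT.
  by move=> _; exact: eE.
have e0 j : 0 <= e j.
  by rewrite -lee_fin -eF integral_ge0 // => w _; rewrite lee_fin.
pose FB B j := if j == j0 then \1_B else F j.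
have split_prod (G : J -> R -> R) w : \prod_j G j (Y j w) =
    (\prod_(j | j != j0) G j (Y j w)) * G j0 (Y j0 w).
  by rewrite (bigD1 j0) //= mulrC.
transitivity (\int[P]_w ((\prod_(j | j != j0) F j (Y j w)) * F j0 (Y j0 w))%:E)%E.
  by apply: eq_integral => w _; rewrite split_prod.
have r0 : 0 <= \prod_(j | j != j0) e j by exact: prodr_ge0.
rewrite (@eq_integral_weight _ (cst (\prod_(j | j != j0) e j))) //=.
- under eq_integral do rewrite EFinM.
  rewrite ge0_integralZl_EFin // ?eF -?EFinM; first by rewrite [in RHS](bigD1 j0) //= mulrC.
  + by move=> w _; rewrite lee_fin.
  + by apply/measurable_EFinP; exact: measurableT_comp (mF j0) (mY j0).
- exact: measurable_prod_fun.
- by move=> w; rewrite prodr_ge0.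
move=> B mB; pose eB j := if j == j0 then fine (P (Y j0 @^-1` B)) else e j.
have mYB : measurable (Y j0 @^-1` B) by rewrite -[X in measurable X]setTI; apply: mY.
have PB : (\int[P]_w (\1_B (Y j0 w))%:E = (fine (P (Y j0 @^-1` B)))%:E)%E.
  transitivity (\int[P]_w (\1_(Y j0 @^-1` B) w)%:E)%E; first by [].

  by rewrite integral_indic // setIT fineK // fin_num_measure.
have mI : measurable_fun setT (\1_B : R -> R) by apply: measurable_indic.
transitivity (\int[P]_w (\prod_j FB B j (Y j w))%:E)%E.
  apply: eq_integral => w _; rewrite split_prod {2}/FB eqxx; congr EFin; congr (_ * _).
  by apply: eq_bigr => j /negbTE jj; rewrite /FB jj.
rewrite (IH (FB B) eB).
- under [RHS]eq_integral do rewrite EFinM.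
  rewrite [RHS]ge0_integralZl_EFin //.
  + rewrite PB -EFinM (bigD1 j0) //= /eB eqxx mulrC; congr EFin; congr (_ * _).
    by apply: eq_bigr => j /negbTE ->.
  + by apply/measurable_EFinP; exact: measurableT_comp mI (mY j0).
- move=> j js; rewrite /FB; case: eqVneq => [_|jj]; first by exists B.
  by apply: sB; rewrite inE negb_or jj.
- by move=> j; rewrite /FB; case: ifP.
- by move=> j y; rewrite /FB; case: ifP.
- by move=> j; rewrite /FB /eB; case: eqP => [->|_].
Qed.

(** Integrability follows from the nonnegative case applied to [|F j|]. For the formula, the
    induction is on the coordinates at which [F] may be negative, and [F j0] is split into its
    positive and negative parts. *)
Lemma indep_prod (F : J -> R -> R) :
  (forall j, measurable_fun setT (F j)) ->
  (forall j, P.-integrable setT (fun w => (F j (Y j w))%:E)) ->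
  P.-integrable setT (fun w => (\prod_j F j (Y j w))%:E) /\
  (\int[P]_w (\prod_j F j (Y j w))%:E =
   (\prod_j fine (\int[P]_w (F j (Y j w))%:E))%:E)%E.
Proof.
move=> mF iF.
have intg (G : J -> R -> R) : (forall j, measurable_fun setT (G j)) ->
  (forall j, P.-integrable setT (fun w => (G j (Y j w))%:E)) ->
  P.-integrable setT (fun w => (\prod_j G j (Y j w))%:E).
  move=> mG iG; apply/integrableP; split.
    by apply/measurable_EFinP; exact: (measurable_prod_fun predT).
  have nG j : (\int[P]_w (`|G j (Y j w)|)%:E = (fine (\int[P]_w (`|G j (Y j w)|)%:E))%:E)%E.
    rewrite fineK // ge0_fin_numE; last by rewrite integral_ge0 // => w _; rewrite lee_fin.
    by have /integrableP[_] := iG j.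
  have := @indep_prod_ge0 (fun j y => `|G j y|) _ _ _ nG.
  under eq_integral do rewrite -normr_prod.
  move=> -> //; first exact: ltry.
  by move=> j; apply: measurableT_comp (mG j).
split; first exact: intg.
have : forall j, j \notin enum J -> forall y, 0 <= F j y.
  by move=> j; rewrite mem_enum.
elim: (enum J) F mF iF => [|j0 s IH] F mF iF sF.
  apply: indep_prod_ge0 => // [j y|j]; first exact: sF.
  by rewrite fineK // integrable_fin_num.
pose Fp y := Num.max (F j0 y) 0; pose Fm y := Num.max (- F j0 y) 0.
have FE y : F j0 y = Fp y - Fm y.
  by rewrite /Fp /Fm; case: (lerP (F j0 y) 0) => H; case: (lerP (- F j0 y) 0) => H'; lra.
have mFp : measurable_fun setT Fp by apply: measurable_maxr.
have mFm : measurable_fun setT Fm.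
  by apply: measurable_maxr => //; apply: measurable_funN.
have iFp : P.-integrable setT (fun w => (Fp (Y j0 w))%:E).
  apply: le_integrable (iF j0) => //.
    by apply/measurable_EFinP; exact: measurableT_comp mFp (mY j0).
  move=> w _; rewrite /= lee_fin /Fp.
  by case: (lerP (F j0 (Y j0 w)) 0) => // _; rewrite normr0.
have iFm : P.-integrable setT (fun w => (Fm (Y j0 w))%:E).
  apply: le_integrable (iF j0) => //.
    by apply/measurable_EFinP; exact: measurableT_comp mFm (mY j0).
  move=> w _; rewrite /= lee_fin /Fm.
  by case: (lerP (- F j0 (Y j0 w)) 0) => _; rewrite ?normr0 ?normrN.
pose G (H : R -> R) j := if j == j0 then H else F j.
have mG H : measurable_fun setT H -> forall j, measurable_fun setT (G H j).
  by move=> mH j; rewrite /G; case: ifP.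
have iG H : P.-integrable setT (fun w => (H (Y j0 w))%:E) ->
    forall j, P.-integrable setT (fun w => (G H j (Y j w))%:E).
  by move=> iH j; rewrite /G; case: eqP => [->|_].
have sG H : (forall y, 0 <= H y) -> forall j, j \notin s -> forall y, 0 <= G H j y.
  move=> H0 j js y; rewrite /G; case: eqVneq => [_ //|jj].
  by apply: sF; rewrite inE negb_or jj.
have GE H w : \prod_j G H j (Y j w) = H (Y j0 w) * \prod_(j | j != j0) F j (Y j w).
  rewrite (bigD1 j0) //= {1}/G eqxx; congr (_ * _).
  by apply: eq_bigr => j /negbTE jj; rewrite /G jj.
have eG H : \prod_j fine (\int[P]_w (G H j (Y j w))%:E) =
    fine (\int[P]_w (H (Y j0 w))%:E) * \prod_(j | j != j0) fine (\int[P]_w (F j (Y j w))%:E).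
  rewrite (bigD1 j0) //= {1}/G eqxx; congr (_ * _).
  by apply: eq_bigr => j /negbTE jj; rewrite /G jj.
have Fp0 y : 0 <= Fp y by rewrite le_max lexx orbT.
have Fm0 y : 0 <= Fm y by rewrite le_max lexx orbT.
transitivity (\int[P]_w ((\prod_j G Fp j (Y j w))%:E - (\prod_j G Fm j (Y j w))%:E))%E.
  apply: eq_integral => w _; rewrite !GE -EFinB -mulrBl -FE.
  by rewrite (bigD1 j0).
rewrite integralB_EFin //; last 2 first.
- by apply: intg; [exact: mG | exact: iG].
- by apply: intg; [exact: mG | exact: iG].
rewrite (IH _ (mG _ mFp) (iG _ iFp) (sG _ Fp0)) (IH _ (mG _ mFm) (iG _ iFm) (sG _ Fm0)).
rewrite -EFinB; congr EFin; rewrite !eG -mulrBl [RHS](bigD1 j0) //=; congr (_ * _).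
have -> : (\int[P]_w (F j0 (Y j0 w))%:E =
    \int[P]_w (Fp (Y j0 w))%:E - \int[P]_w (Fm (Y j0 w))%:E)%E.
  rewrite -integralB_EFin //; apply: eq_integral => w _.
  by rewrite -EFinB -FE.
exact: esym (fineB (integrable_fin_num measurableT iFp) (integrable_fin_num measurableT iFm)).
Qed.
End Family.
End Independence.

(** * Expectation of the trace *)

(** As [k <= 3 * (k - 2)] for [k >= 3], a high moment is charged to the [k - 2] excess traversals of
    its edge. Hence the factor 3 in front of [beta]. *)
Lemma powR_moment (R : realType) (beta : R) (b N k : nat) :
  0 < beta -> 3%:R * beta <= b%:R -> (2 < k <= N)%N ->
  k%:R `^ (beta * k%:R) <= (N ^ b)%:R ^+ (k - 2) :> R.
Proof.
move=> beta0 bb /andP[k3 kN].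
have k0 : (0 < k)%N by apply: ltn_trans k3.
have N1 : 1 <= N%:R :> R by rewrite ler1n (leq_trans k0).
apply: le_trans (_ : N%:R `^ (beta * k%:R) <= _).
  by rewrite ge0_ler_powR ?nnegrE ?mulr_ge0 ?ler_nat // ltW.
rewrite natrX -exprM -powR_mulrn ?ler_powR //.
apply: le_trans (_ : (3%:R * beta) * (k - 2)%:R <= _); last first.
  by rewrite natrM ler_wpM2r.
have h : k%:R <= 3%:R * (k - 2)%:R :> R by rewrite -natrM ler_nat; lia.
rewrite -[leRHS]mulrA [leRHS]mulrCA; exact: ler_wpM2l (ltW beta0) _ _ h.
Qed.

Section Moments.
Context dT (T : measurableType dT) (R : realType) (P : probability T R).
Variables (n p : nat) (X : 'I_n -> 'I_p -> T -> R) (beta : R) (b : nat).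
Hypothesis beta_gt0 : 0 < beta.
Hypothesis b_beta : 3%:R * beta <= b%:R.
Hypothesis mX : forall i j, measurable_fun setT (X i j).
Hypothesis Xind : mutually_independent P (fun ij : 'I_n * 'I_p => X ij.1 ij.2).
Hypothesis X1 : forall i j, ('E_P[X i j] = 0)%E.
Hypothesis X2 : forall i j, ('E_P[fun w => (X i j w ^+ 2)%R] = 1)%E.
Hypothesis Xk : forall i j (k : nat),
  ('E_P[fun w => (`|X i j w| ^+ k)%R] <= (k%:R `^ (beta * k%:R))%:E)%E.

Lemma expectE (f : T -> R) : ('E_P[f] = \int[P]_w (f w)%:E)%E.
Proof. by rewrite unlock. Qed.

Lemma pow_integrable i j k : P.-integrable setT (fun w => (X i j w ^+ k)%:E).
Proof.
apply/integrableP; split.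
  by apply/measurable_EFinP; exact: measurable_funX.
have := Xk i j k; rewrite expectE.
under eq_integral do rewrite -normrX.
by move=> /le_lt_trans; apply; rewrite ltry.
Qed.

Lemma pow_moment i j k N : (k <= N)%N ->
  `|fine (\int[P]_w (X i j w ^+ k)%:E)%E| <= (k != 1%N)%:R * (N ^ b)%:R ^+ (k - 2).
Proof.
case: k => [|[|[|k]]] kN.
- rewrite !mul1r expr0 (_ : (\int[P]_w _ = 1)%E) /= ?normr1 //.
  under eq_integral do rewrite expr0.
  by rewrite integral_cst //= mul1e probability_setT.
- by rewrite mul0r -[X in fine X]expectE X1 normr0.
- by rewrite expr0 mulr1 -expectE X2 normr1.
rewrite mul1r; apply: le_trans (powR_moment beta_gt0 b_beta (_ : 2 < k.+3 <= N)%N) => //.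
rewrite -lee_fin; apply: le_trans (Xk i j k.+3); rewrite expectE.
have fin := integrable_fin_num measurableT (pow_integrable i j k.+3).
rewrite -abse_EFin fineK //; apply: le_trans (le_abse_integral _ _ _) _ => //.
  by apply/measurable_EFinP; exact: measurable_funX.
rewrite le_eqVlt; apply/orP; left; apply/eqP; apply: eq_integral => w _.
by rewrite /= normrX.
Qed.

Lemma monomial_moment (c : 'I_n -> 'I_p -> nat) N : (forall u a, c u a <= N)%N ->
  P.-integrable setT (fun w => (\prod_u \prod_a X u a w ^+ c u a)%:E) /\
  `|fine (\int[P]_w (\prod_u \prod_a X u a w ^+ c u a)%:E)%E| <=
    [forall u, forall a, c u a != 1%N]%:R * (N ^ b)%:R ^+ (\sum_u \sum_a (c u a - 2))%N.
Proof.
move=> cN.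
have [] := @indep_prod _ _ _ P _ _ (fun ij => mX ij.1 ij.2) Xind
  (fun ij y => y ^+ c ij.1 ij.2) (fun ij => exprn_measurable _) (fun ij => pow_integrable _ _ _).
have E w : \prod_(ij : 'I_n * 'I_p) X ij.1 ij.2 w ^+ c ij.1 ij.2 =
    \prod_u \prod_a X u a w ^+ c u a.
  by rewrite pair_bigA.
under eq_fun do rewrite E.
move=> int1 ->; split => //=; rewrite normr_prod.
apply: le_trans (_ : \prod_(ij : 'I_n * 'I_p) ((c ij.1 ij.2 != 1%N)%:R *
    (N ^ b)%:R ^+ (c ij.1 ij.2 - 2)) <= _).
  by apply: ler_prod => ij _; rewrite normr_ge0 pow_moment.
rewrite big_split /= pair_bigA /= -expr_sum ler_wpM2r ?exprn_ge0 //.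
case: (boolP [forall u, _]) => [//|/forallPn[u /forallPn[a /negPn ca]]]; last first.
  by rewrite (bigD1 (u, a)) //= ca mul0r.
by move=> _; apply: prodr_ile1 => ij _; case: (_ != _); rewrite /= ?lexx ?ler01.
Qed.

Lemma sum_walks_integral (I K : finType) m (F : seq (I * K) -> T -> R) :
  (forall h, P.-integrable setT (fun w => (F h w)%:E)) ->
  P.-integrable setT (fun w => (sum_walks m (fun h => F h w))%:E) /\
  fine (\int[P]_w (sum_walks m (fun h => F h w))%:E)%E =
    sum_walks m (fun h => fine (\int[P]_w (F h w)%:E)%E).
Proof.
elim: m F => [|m IH] F iF /=; first by split.
have iS x : P.-integrable setT (fun w => (sum_walks m (fun h => F (x :: h) w))%:E).
  by have [] := IH (fun h => F (x :: h)) (fun h => iF _).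
split.
  under eq_fun do rewrite -sumEFin.
  by apply: integrable_sum.
under eq_integral do rewrite -sumEFin.
rewrite integral_sum // (eq_bigr (fun x =>
  (sum_walks m (fun h => fine (\int[P]_w (F (x :: h) w)%:E)%E))%:E)); last first.
  move=> x _; have [_ <-] := IH (fun h => F (x :: h)) (fun h => iF _).
  by rewrite fineK // integrable_fin_num.
by rewrite sumEFin.
Qed.

Variables (d L s C0 : nat).
Hypotheses (d_gt0 : (0 < d)%N) (L_gt0 : (0 < L)%N) (s_gt0 : (0 < s)%N)
  (n_gt0 : (0 < n)%N) (p_gt0 : (0 < p)%N) (C0_gt0 : (0 < C0)%N)
  (pdn : (p ^ d <= C0 * n)%N).
(** The number of all edge traversals of a walk, hence a bound on each multiplicity. *)
Let N := (2 * d * (2 * s * L))%N.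
Hypothesis big_p : ((N ^ b) ^ 2 * growth_const d L C0 ^ 16 *
  (L * ((1 + 2 * s * L) * (1 + d * (2 * s * L)) ^ d) * d`! * C0) ^ (2 * (1 + 5 * d))
   * (d`! * C0) <= p)%N.

Definition trace_power w := \sum_(i : incr d p)
  mpow (fun i j => Tmat L (fun u a => X u a w) i j) (2 * s) i i.

Lemma mpow_scale (I : finType) (c : R) (M : I -> I -> R) r i j :
  mpow (fun i j => c * M i j) r i j = c ^+ r * mpow M r i j.
Proof.
elim: r i => [|r IH] i /=; first by rewrite mul1r.
rewrite mulr_sumr; apply: eq_bigr => k _; rewrite IH exprS.
by rewrite !mulrA; congr (_ * _); rewrite -!mulrA; congr (_ * _); rewrite mulrC.
Qed.

Lemma eq_mpow (I : finType) (M1 M2 : I -> I -> R) r i j :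
  (forall i j, M1 i j = M2 i j) -> mpow M1 r i j = mpow M2 r i j.
Proof.
move=> E; elim: r i => [|r IH] i //=; apply: eq_bigr => k _.
by rewrite E IH.
Qed.

Notation co := (fun k : incr d p => tval (incr_tuple k)).
Notation mono i h w := (\prod_u \prod_a X u a w ^+ edge_mult co i h u a).

Lemma trace_powerE w : trace_power w = Tmat_factor R n p d L ^+ (2 * s) *
  \sum_(i : incr d p) sum_walks (2 * s * L) (fun h => (nonbacktracking L i h && (current i h == i))%:R * mono i h w).
Proof.
rewrite /trace_power mulr_sumr; apply: eq_bigr => i _.
rewrite (eq_mpow _ _ _ (fun i j => Tmat_walks (fun u a => X u a w) L_gt0 i j)).
rewrite mpow_scale walks_pow /walks; congr (_ * _); apply: eq_sum_walks => h _.
by rewrite (walk_weightE _ (@incr_tuple_uniq d p)).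
Qed.

Lemma Tmat_factor_pow : Tmat_factor R n p d L ^+ (2 * s) = (d`!%:R / (n%:R * p%:R ^+ d)) ^+ (s * L).
Proof.
rewrite exprM /Tmat_factor expr_div_n -exprM mulnC exprM sqr_sqrtr // sqr_sqrtr; last first.
  by rewrite mulr_ge0 // exprn_ge0.
by rewrite (mulnC s) [RHS]exprM; congr (_ ^+ _); rewrite expr_div_n exprMn -exprM.
Qed.

Lemma trace_moment : P.-integrable setT (fun w => (trace_power w)%:E) /\
  fine (\int[P]_w (trace_power w)%:E)%E <=
    p%:R ^+ d * (expR 4 * (growth_const d L C0 ^ 21)%:R) ^+ s.
Proof.
pose F (k : incr d p) h w := (nonbacktracking L k h && (current k h == k))%:R * mono k h w.
have NL k (h : seq ('I_n * incr d p)) : size h = (2 * s * L)%N ->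
    forall u a, (edge_mult co k h u a <= N)%N.
  move=> hM u a; have size_co k' : size (co k') = d by rewrite size_tuple.
  rewrite /N -hM; have <- := sum_edge_mult k (@incr_tuple_uniq d p) size_co d_gt0 h.
  by rewrite (bigD1 u) //= (bigD1 a) //= -addnA leq_addr.
have iF : forall k h, P.-integrable setT (fun w => (F k h w)%:E).
  move=> k h.
  under eq_fun do rewrite /F EFinM.
  apply: integrableZl => //.
  have [] // := @monomial_moment (edge_mult co k h) (\sum_u \sum_a edge_mult co k h u a)%N.
  by move=> u a; rewrite (bigD1 u) //= (bigD1 a) //= -addnA leq_addr.
have iS k := proj1 (sum_walks_integral (2 * s * L) (iF k)).
have eS k := proj2 (sum_walks_integral (2 * s * L) (iF k)).
have itr : P.-integrable setT (fun w => (\sum_k sum_walks (2 * s * L) (fun h => F k h w))%:E).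
  by under eq_fun do rewrite -sumEFin; apply: integrable_sum.
split.
  under eq_fun do rewrite trace_powerE EFinM.
  exact: integrableZl.
have -> : (\int[P]_w (trace_power w)%:E = (Tmat_factor R n p d L ^+ (2 * s) *
   \sum_k sum_walks (2 * s * L) (fun h => fine (\int[P]_w (F k h w)%:E)%E))%:E)%E.
  under eq_integral do rewrite trace_powerE EFinM.
  rewrite integralZl // EFinM; congr (_ * _)%E.
  under eq_integral do rewrite -sumEFin.
  rewrite integral_sum // -sumEFin; apply: eq_bigr => k _.
  by rewrite -eS fineK // integrable_fin_num.
rewrite /= Tmat_factor_pow.
have D0 : 0 < d`!%:R :> R by rewrite ltr0n fact_gt0.
have n0 : 0 < n%:R :> R by rewrite ltr0n.
have p0 : 0 < p%:R :> R by rewrite ltr0n.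
have N0 : (0 < N ^ b)%N by rewrite expn_gt0 !muln_gt0 d_gt0 s_gt0 L_gt0.
have H : \sum_k sum_walks (2 * s * L) (fun h => fine (\int[P]_w (F k h w)%:E)%E) <=
    p%:R ^+ d * (1 + 2%:R / L%:R) ^+ (2 * s * L) * (growth_const d L C0 ^ 21)%:R ^+ s *
    (n%:R * p%:R ^+ d / d`!%:R) ^+ (s * L).
  apply: le_trans (moment_sum R d_gt0 L_gt0 s_gt0 n_gt0 p_gt0 C0_gt0 N0 pdn big_p).
  apply: ler_sum => k _; apply: ler_sum_walks => h hM.
  have [iM bM] := monomial_moment (NL k h hM).
  apply: le_trans (ler_norm _) _.
  rewrite /F; under eq_integral do rewrite EFinM.
  rewrite integralZl // fineM ?integrable_fin_num //= normrM normr_nat.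
  case: (nonbacktracking L k h); last by rewrite !mul0r.
  case: (current k h == k) => /=; last by rewrite mul0r mulr_ge0 ?exprn_ge0.
  by rewrite mul1r.
apply: le_trans (_ : (d`!%:R / (n%:R * p%:R ^+ d)) ^+ (s * L) * _ <= _).
  by apply: ler_wpM2l H; rewrite exprn_ge0 // divr_ge0 // mulr_ge0 // exprn_ge0.
rewrite mulrCA -exprMn.
have -> : d`!%:R / (n%:R * p%:R ^+ d) * (n%:R * p%:R ^+ d / d`!%:R) = 1 :> R.
  by field; rewrite ?gt_eqF // exprn_gt0.
rewrite expr1n mulr1 -mulrA ler_wpM2l ?exprn_ge0 // exprMn ler_wpM2r ?exprn_ge0 //.
apply: le_trans (_ : expR (2%:R / L%:R) ^+ (2 * s * L) <= _).
  by rewrite lerXn2r ?nnegrE ?expR_ge0 ?expR_ge1Dx // addr_ge0 // divr_ge0.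
rewrite -!expRM_natl ler_expR !natrM.
have L0 : L%:R != 0 :> R by rewrite pnatr_eq0 -lt0n.
by rewrite le_eqVlt; apply/orP; left; apply/eqP; field.
Qed.

End Moments.

(** * Almost sure bound *)

(** Halving [k]: one factor [2 ^ j] absorbs the power [B], by induction, and the other absorbs the
    additional factor [j.+1]. *)
Lemma poly_le_exp2 A B : exists k0, forall k, (k0 <= k)%N -> (A * k.+1 ^ B <= 2 ^ k)%N.
Proof.
elim: B A => [|B IH] A.
  exists A => k Ak; rewrite muln1; apply: leq_trans (ltnW (ltn_expl A (_ : 1 < 2)%N)) _ => //.
  by rewrite leq_exp2l.
have [k0 H] := IH (A * 2 ^ B.+1)%N; exists (k0.*2) => k hk.
pose j := k./2; have kj : (k.+1 <= 2 * j.+1)%N by rewrite /j; lia.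
have j0 : (k0 <= j)%N by rewrite /j; lia.
apply: leq_trans (_ : 2 ^ j * 2 ^ j <= _)%N; last first.
  by rewrite -expnD leq_exp2l // /j; lia.
apply: leq_trans (_ : A * 2 ^ B.+1 * j.+1 ^ B * j.+1 <= _)%N; last first.
  by apply: leq_mul; [exact: H | exact: ltn_expl].
rewrite -!mulnA leq_mul2l -expnSr -expnMn; apply/orP; right.
exact: leq_expn_base.
Qed.

(* [s = 2 ^ log_scale p] satisfies [p <= 2 ^ s] and [s = O(log p)]. *)
Definition log_scale (p : nat) := (trunc_log 2 (trunc_log 2 p).+1).+1.

Lemma log_scaleP p : (0 < p)%N ->
  (p <= 2 ^ (2 ^ log_scale p))%N /\ (2 ^ log_scale p <= 2 * (trunc_log 2 p).+1)%N.
Proof.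
move=> p0; rewrite /log_scale.
have /andP[_ H1] := trunc_log_bounds (isT : 1 < 2)%N p0.
have /andP[H2 H3] := trunc_log_bounds (isT : 1 < 2)%N (isT : 0 < (trunc_log 2 p).+1)%N.
split; last by rewrite expnS leq_mul2l.
by apply: leq_trans (ltnW H1) _; rewrite leq_exp2l // ltnW.
Qed.

(* The left-hand side of the largeness condition on [p] in [trace_moment]. *)
Definition threshold (d L C0 b s : nat) :=
  (((2 * d * (2 * s * L)) ^ b) ^ 2 * growth_const d L C0 ^ 16 *
  (L * ((1 + 2 * s * L) * (1 + d * (2 * s * L)) ^ d) * d`! * C0) ^ (2 * (1 + 5 * d))
   * (d`! * C0))%N.

(** The threshold is at most a constant times [s ^ B], where [s] is logarithmic in [p]. *)
Lemma threshold_le d L C0 b : exists k0, forall p, (0 < p)%N -> (k0 <= trunc_log 2 p)%N ->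
  (threshold d L C0 b (2 ^ log_scale p) <= p)%N.
Proof.
pose e := (2 * (1 + 5 * d))%N; pose B := (b * 2 + (1 + d) * e)%N.
have poly s : (0 < s)%N -> (threshold d L C0 b s <= threshold d L C0 b 1 * s ^ B)%N.
  move=> s0; rewrite /threshold -/e !muln1.
  apply: leq_trans (_ : (((2 * d * (2 * L)) * s) ^ b) ^ 2 * growth_const d L C0 ^ 16 *
     (L * ((1 + 2 * L) * s * ((1 + d * (2 * L)) * s) ^ d) * d`! * C0) ^ e * (d`! * C0) <= _)%N.
    rewrite leq_mul2r; apply/orP; right; apply: leq_mul.
      by rewrite leq_mul2r; apply/orP; right; do 2! apply: leq_expn_base; lia.
    apply: leq_expn_base; rewrite !leq_mul2r; do 2! (apply/orP; right).
    rewrite leq_mul2l; apply/orP; right; apply: leq_mul; first by lia.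
    by apply: leq_expn_base; nia.
  have -> : (L * ((1 + 2 * L) * s * ((1 + d * (2 * L)) * s) ^ d) * d`! * C0 =
      L * ((1 + 2 * L) * (1 + d * (2 * L)) ^ d) * d`! * C0 * s ^ (1 + d))%N.
    by rewrite expnMn expnD expn1; ring.
  move: (_ * d`! * C0)%N (growth_const _ _ _ ^ 16)%N (d`! * C0)%N => x g y.
  rewrite (expnMn _ s b) (expnMn _ _ 2) (expnMn x).
  have -> : (s ^ B = (s ^ b) ^ 2 * (s ^ (1 + d)) ^ e)%N by rewrite /B expnD !expnM.
  by rewrite leq_eqVlt; apply/orP; left; apply/eqP; ring.
have [k0 H] := poly_le_exp2 (threshold d L C0 b 1 * 2 ^ B) B.
exists k0 => p p0 /H Hk; have [_ sk] := log_scaleP p0.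
apply: leq_trans (poly _ _) _; first by rewrite expn_gt0.
have /andP[pk _] := trunc_log_bounds (isT : 1 < 2)%N p0.
apply: leq_trans pk; apply: leq_trans Hk.
rewrite -mulnA -expnMn leq_mul2l; apply/orP; right; exact: leq_expn_base.
Qed.

Lemma limn_esup_le (R : realType) (u : (\bar R)^nat) (c : \bar R) N :
  (forall n, (N <= n)%N -> (u n <= c)%E) -> (limn_esup u <= c)%E.
Proof.
move=> H; apply: (@le_trans _ _ (ereal_sup (u @` [set n | (N <= n)%N]))).
  apply: ereal_inf_lbound; exists [set n | (N <= n)%N] => //; exact: nbhs_infty_ge.
by apply: ge_ereal_sup => _ [n /= Nn <-]; exact: H.
Qed.

Lemma summable_inv_sq (R : realType) (u : (\bar R)^nat) (C : R) :
  (forall n, 0 <= u n)%E -> 0 <= C ->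
  (forall n, u n <= (C / (n.+1 * n.+2)%:R)%:E)%E -> (\sum_(n <oo) u n < +oo)%E.
Proof.
move=> u0 C0 uC; apply: le_lt_trans (ltry C).
apply: lime_le; first exact: is_cvg_nneseries.
apply: nearW => N.
apply: le_trans (_ : (\sum_(0 <= n < N) (C / (n.+1 * n.+2)%:R)%:E <= _)%E).
  by apply: lee_sum => n _.
rewrite sumEFin lee_fin.
have -> : \sum_(0 <= n < N) C / (n.+1 * n.+2)%:R = C - C / N.+1%:R.
  elim: N => [|N IH]; first by rewrite big_geq // divr1 subrr.
  rewrite big_nat_recr //= IH natrM; field.
  by rewrite -(natrD _ 2 N) -(natrD _ 1 N) !pnatr_eq0.
by rewrite gerBl divr_ge0.
Qed.

Lemma mpow_trace_ge0 (R : realFieldType) (I : finType) (M : I -> I -> R) s :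
  (forall i j, M i j = M j i) -> 0 <= \sum_i mpow M (2 * s) i i.
Proof.
move=> sM; rewrite mul2n -addnn sumr_ge0 // => i _; rewrite mpow_add sumr_ge0 // => k _.
by rewrite (mpow_sym sM s k i) -expr2 sqr_ge0.
Qed.

Lemma markov_ge0 dT (T : measurableType dT) (R : realType) (P : probability T R)
    (Z : T -> R) (t m : R) :
  P.-integrable setT (fun w => (Z w)%:E) -> (forall w, 0 <= Z w) -> 0 < t ->
  fine (\int[P]_w (Z w)%:E)%E <= m ->
  measurable [set w | t < Z w] /\ (P [set w | (t < Z w)%R] <= (m / t)%:E)%E.
Proof.
move=> iZ Z0 t0 Em.
have mZ : measurable_fun setT Z by apply/measurable_EFinP; exact: measurable_int iZ.
have mS : measurable [set w | t < Z w].
  have -> : [set w | t < Z w] = Z @^-1` `]t, +oo[.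
    by apply/seteqP; split => w /=; rewrite in_itv /= andbT.
  by rewrite -[X in measurable X]setTI; apply: mZ.
split => //.
have fi := integrable_fin_num measurableT iZ.
rewrite EFinM lee_pdivlMr // muleC.
apply: le_trans (_ : (\int[P]_w (Z w)%:E <= _)%E); last by rewrite -(fineK fi) lee_fin.
rewrite -[X in P X]setIT -integral_indic // -ge0_integralZl_EFin //; last 2 first.
- by apply/measurable_EFinP; exact: measurable_indic.
- exact: ltW.
apply: ge0_le_integral => //.
- by move=> w _; rewrite lee_fin mulr_ge0 // ltW.
- by apply/measurable_EFinP; apply: measurable_funM => //; exact: measurable_indic.
- by apply/measurable_EFinP.
move=> w _; rewrite lee_fin indicE.
case: (boolP (w \in _)) => [|_]; last by rewrite mulr0.
by rewrite inE /= mulr1 => /ltW.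
Qed.

Theorem theorem5p9
  (dT : measure_display) (T : measurableType dT) (R : realType)
  (P : probability T R)
  (ell : nat) (gamma beta : R) (p : nat -> nat)
  (X : forall n : nat, 'I_n -> 'I_(p n) -> T -> R) :
  (0 < ell)%N -> 0 < gamma -> 0 < beta ->
  (fun n => (p n)%:R : R) @ \oo --> +oo ->
  (fun n => (n%:R / (p n)%:R ^+ ell : R)) @ \oo --> gamma ->
  (forall n (i : 'I_n) (j : 'I_(p n)), measurable_fun setT (X n i j)) ->
  (forall n, mutually_independent P
     (fun ij : 'I_n * 'I_(p n) => X n ij.1 ij.2)) ->
  (forall n (i : 'I_n) (j : 'I_(p n)), ('E_P[X n i j])%E = 0%E) ->
  (forall n (i : 'I_n) (j : 'I_(p n)), ('E_P[fun w => (X n i j w ^+ 2)%R])%E = 1%E) ->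
  (forall n (i : 'I_n) (j : 'I_(p n)) (k : nat),
     (('E_P[fun w => (`|X n i j w| ^+ k)%R])%E <= ((k%:R) `^ (beta * k%:R))%:E)%E) ->
  forall d : nat, (0 < d)%N -> (d <= ell)%N ->
  exists C1 C3 : R, 0 < C1 /\ 0 < C3 /\
    forall L : nat, (0 < L)%N ->
      {ae P, forall w : T,
        (limn_esup (fun n =>
           (spec_norm (@Tmat R n (p n) d L (fun i j => X n i j w)))%:E)
         <= ((C1 * L%:R) `^ C3)%:E)%E}.
Proof.
move=> ell0 gamma0 beta0 pinf ngam mX Xind X1 X2 Xk d d0 dl.
pose b := Num.bound (3%:R * beta).
have bb : 3%:R * beta <= b%:R by apply/ltW/archi_boundP; rewrite mulr_ge0 // ltW.
(* Eventually [p ^ ell < (2 / gamma) * n], hence [p ^ d <= C0 * n] for [d <= ell]. *)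
pose C0 := Num.bound (2%:R / gamma).
have C0b : 2%:R / gamma < C0%:R by apply/archi_boundP; rewrite divr_ge0 // ltW.
have C0_gt0 : (0 < C0)%N by rewrite -(ltr0n R); apply: lt_trans C0b; rewrite divr_gt0.
pose C2 := Num.bound (2%:R * gamma).
have C2b : 2%:R * gamma < C2%:R by apply/archi_boundP; rewrite mulr_ge0 // ltW.
pose K1 := (2 * (1 + 2 * d) ^ d)%N.
pose C1 : R := (2 ^ (d + 2 * ell))%:R * expR 4 * (K1 * d`! * C0)%:R.
have C11 : 1 <= C1.
  have e1 : 1 <= expR 4 :> R by rewrite -[1]expR0 ler_expR.
  have k1 : 1 <= (K1 * d`! * C0)%:R :> R.
    by rewrite ler1n !muln_gt0 fact_gt0 C0_gt0 expn_gt0.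
  have p1 : 1 <= (2 ^ (d + 2 * ell))%:R :> R by rewrite ler1n expn_gt0.
  by rewrite /C1 mulr_ege1 // mulr_ege1.
exists C1, 21%:R; split; first exact: lt_le_trans C11.
split => // L L0.
have [k0 Hk0] := threshold_le d L C0 b.
have [N0 HN0] : exists N0, forall n, (N0 <= n)%N -> [/\ (0 < n)%N, (0 < p n)%N,
    (k0 <= trunc_log 2 (p n))%N, (p n ^ d <= C0 * n)%N & (n <= C2 * p n ^ ell)%N].
  have /cvgryPgt/(_ (2 ^ k0)%:R)[n1 _ H1] := pinf.
  have g1 : gamma / 2%:R < gamma by rewrite ltr_pdivrMr // ltr_pMr // ltr1n.
  have g2 : gamma < 2%:R * gamma by rewrite ltr_pMl // ltr1n.
  have [n2 _ H2] := cvgr_gt _ ngam _ g1.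
  have [n3 _ H3] := cvgr_lt _ ngam _ g2.
  exists (maxn 1 (maxn n1 (maxn n2 n3))) => n; rewrite !geq_max => /and4P[n_gt0 h1 h2 h3].
  have {H1} := H1 n h1; have {H2} := H2 n h2; have {H3} := H3 n h3; rewrite /= ltr_nat.
  move=> r2 r1 pk; have p0 : (0 < p n)%N by apply: leq_ltn_trans pk.
  have pe : 0 < (p n)%:R ^+ ell :> R by rewrite exprn_gt0 // ltr0n.
  rewrite ltr_pdivrMr // in r2; rewrite ltr_pdivlMr // in r1.
  split => //; first by rewrite trunc_log_max // ltnW.
  - apply: leq_trans (_ : p n ^ ell <= _)%N; first by rewrite leq_pexp2l.
    rewrite -(ler_nat R) natrM natrX ltW //.
    apply: lt_trans (_ : 2%:R / gamma * n%:R < _); last by rewrite ltr_pM2r ?ltr0n.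
    by rewrite -(ltr_pM2l (_ : 0 < gamma / 2%:R)) ?divr_gt0 // !mulrA divfK ?gt_eqF // mulfV ?gt_eqF // mul1r.
  - rewrite -(ler_nat R) natrM natrX ltW //; apply: lt_trans r2 _.
    by rewrite ltr_pM2r.
pose s n := (2 ^ log_scale (p n))%N.
have s_gt0 n : (0 < s n)%N by rewrite expn_gt0.
pose Q := (growth_const d L C0 ^ 21)%N.
pose Z n w := trace_power (X n) d L (s n) w.
have Z0 n w : 0 <= Z n w by apply: mpow_trace_ge0 => i j; exact: Tmat_sym.
have ZE n : (N0 <= n)%N -> P.-integrable setT (fun w => (Z n w)%:E) /\
   fine (\int[P]_w (Z n w)%:E)%E <= (p n)%:R ^+ d * (expR 4 * Q%:R) ^+ s n.
  move=> /HN0[n0 p0 pk pC _].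
  exact: (trace_moment beta0 bb (mX n) (Xind n) (X1 n) (X2 n) (Xk n)
    d0 L0 (s_gt0 n) n0 p0 C0_gt0 pC (Hk0 _ p0 pk)).
have Qp : 0 < expR 4 * Q%:R :> R.
  rewrite mulr_gt0 ?expR_gt0 // ltr0n expn_gt0 !muln_gt0.
  by rewrite L0 fact_gt0 C0_gt0 expn_gt0.
(* The bound on the mean of [Z n], enlarged by [p ^ (2 * ell)]. As [n <= C2 * p ^ ell], Markov's
   inequality leaves a probability of order $n^{-2}$, which is summable. *)
pose th n : R := (p n)%:R ^+ (d + 2 * ell) * (expR 4 * Q%:R) ^+ s n.
pose F n : set T := if (N0 <= n)%N then [set w | th n < Z n w] else set0.
(* The constant 6 comes from [n.+1 * n.+2 <= 6 * n ^ 2] for [n >= 1]. *)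
pose Cs : R := 6%:R * C2%:R ^+ 2.
have FP n : measurable (F n) /\ (P (F n) <= (Cs / (n.+1 * n.+2)%:R)%:E)%E.
  have Cs0 : 0 <= Cs by rewrite mulr_ge0 // exprn_ge0.
  rewrite /F; case: ifP => [Nn|_]; last first.
    by split => //; rewrite measure0 lee_fin divr_ge0.
  have [n0 p0 _ _ nC] := HN0 n Nn; have [iZ eZ] := ZE n Nn.
  have pR : 0 < (p n)%:R :> R by rewrite ltr0n.
  have th0 : 0 < th n by rewrite mulr_gt0 // exprn_gt0.
  have [mF PF] := markov_ge0 iZ (Z0 n) th0 eZ.
  split => //; apply: le_trans PF _; rewrite lee_fin /th exprD.
  have a0 : (p n)%:R ^+ d != 0 :> R by rewrite gt_eqF // exprn_gt0.
  have e0 : (p n)%:R ^+ (2 * ell) != 0 :> R by rewrite gt_eqF // exprn_gt0.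
  have y0 : (expR 4 * Q%:R) ^+ s n != 0 :> R by rewrite gt_eqF // exprn_gt0.
  move: ((expR 4 * Q%:R) ^+ s n) y0 => y y0.
  have -> : (p n)%:R ^+ d * y / ((p n)%:R ^+ d * (p n)%:R ^+ (2 * ell) * y) =
      ((p n)%:R ^+ (2 * ell))^-1 by field; rewrite y0 e0 a0.
  rewrite ler_pdivlMr ?ltr0n // mulrC ler_pdivrMr ?exprn_gt0 //.
  rewrite /Cs -!natrX -!natrM ler_nat -mulnA (mulnC 2) expnM -expnMn.
  have n6 : (n.+1 * n.+2 <= 6 * n ^ 2)%N by rewrite -mulnn; move: n0; clear; nia.
  by apply: leq_trans n6 _; apply: leq_mul => //; exact: leq_expn_base.
have lim0 : P (lim_sup_set F) = 0%E.
  apply: lim_sup_set_cvg0; first by move=> n; case: (FP n).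
  apply: (@summable_inv_sq _ _ Cs) => //; first by rewrite mulr_ge0 // exprn_ge0.
  by move=> n; case: (FP n).
exists (lim_sup_set F); split => //.
  apply: bigcapT_measurable => k; apply: bigcup_measurable => j _.
  by case: (FP j).
move=> w /= nb; apply: contrapT => nw; apply: nb.
have [N1 HN1] : exists N1, forall n, (N1 <= n)%N -> ~ F n w.
  apply: contrapT => H; apply: nw => k _; apply: contrapT => nk; apply: H.
  by exists k => n kn Fw; apply: nk; exists n.
apply: (limn_esup_le (N := maxn N0 N1)) => n; rewrite geq_max => /andP[hN0 hN1].
have [n0 p0 _ _ _] := HN0 n hN0.
have Zth : Z n w <= th n.
  by rewrite leNgt; apply/negP => h; apply: (HN1 n hN1); rewrite /F hN0.
(* Since [p <= 2 ^ s], the factor [p ^ (d + 2 * ell)] of the threshold [th n] only adds a constant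
   to its [s]-th root. *)
pose B : R := (2 ^ (d + 2 * ell))%:R * (expR 4 * Q%:R).
have B0 : 0 < B by rewrite mulr_gt0 // ltr0n expn_gt0.
have sB : spec_norm (@Tmat R n (p n) d L (fun i j => X n i j w)) <= Num.sqrt B.
  apply: (spec_norm_le (q := log_scale (p n))); [exact: Tmat_sym|exact: ltW|].
  apply: le_trans Zth _; rewrite /th /B -/(s n) [leRHS]exprMn ler_wpM2r ?exprn_ge0 ?(ltW Qp) //.
  rewrite -!natrX ler_nat -expnM (mulnC _ (s n)) expnM.
  by apply: leq_expn_base; have [] := log_scaleP p0.
rewrite lee_fin; apply: le_trans sB _.
have CL1 : 1 <= C1 * L%:R by rewrite mulr_ege1 // ler1n.
rewrite powR_mulrn; last exact: le_trans CL1.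
(* [B] is [A] times the 21st power of [growth_const], and [C1] is chosen such that [C1 * L] is [A]
   times [growth_const]; as [A >= 1], its 21st power dominates [B]. *)
have BC : B <= (C1 * L%:R) ^+ 21.
  pose A : R := (2 ^ (d + 2 * ell))%:R * expR 4.
  have A1 : 1 <= A.
    rewrite /A mulr_ege1 //; first by rewrite ler1n expn_gt0.
    by rewrite -[1]expR0 ler_expR.
  have -> : C1 * L%:R = A * (growth_const d L C0)%:R.
    by rewrite /C1 -/A /growth_const -/K1 -mulrA -natrM; congr (_ * _%:R); lia.
  rewrite /B /Q [(growth_const _ _ _ ^ _)%:R]natrX mulrA -/A exprMn ler_wpM2r ?exprn_ge0 //.
  by apply: ler_eXnr.
apply: le_trans (_ : (C1 * L%:R) ^+ 21 <= _); last by [].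
rewrite -[leRHS]ger0_norm ?exprn_ge0 ?(le_trans ler01) // -sqrtr_sqr ler_sqrt ?sqr_ge0 //.
apply: le_trans BC _; apply: ler_eXnr => //; exact: exprn_ege1.
Qed.
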